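(* Let $d\ge 2$ be an integer and let $\|\cdot\|_2$ be the Euclidean norm on $\mathbb{R}^d$. For $C>0$ sufficiently small (in terms of $d$) there exists $\delta>0$ such that for every $\varepsilon$ with $0<\varepsilon<C$ the following hold: (1) the set $[\varepsilon,\varepsilon(1+\delta\varepsilon^{d})]\cap \mathcal{L}_{d}(\|\cdot\|_{2})$ is non-empty; (2) $$\dim_{H} \left\{ \mathbf{x} \in \mathbb{R}^{d}: \varepsilon \leq \Theta_{d}(\mathbf{x}, \|\cdot\|_{2}) \leq \varepsilon(1+\delta \varepsilon^{d})\right\}>0.$$ Furthermore, for any function $\Delta:\mathbb{R}_{+}\to\mathbb{R}_{+}$ with $\Delta(r)\to \infty$ as $r\to 0$, $$\lim_{\varepsilon\to0}\, \dim_{H} \left\{ \mathbf{x} \in \mathbb{R}^{d}: \varepsilon \leq \Theta_{d}(\mathbf{x}, \|\cdot\|_{2}) \leq \varepsilon(1+\Delta(\varepsilon) \varepsilon^{d})\right\}=d .$$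
   Context: For $\mathbf{x}\in\mathbb{R}^d$ and a norm $\|\cdot\|$ on $\mathbb{R}^d$, the best approximation constant of $\mathbf{x}$ is $$\Theta_{d}(\mathbf{x}, \|\cdot\|):=\liminf_{q\to\infty}\left(q^{1/d}\min_{\mathbf{p}\in\mathbb{Z}^{d}}\|q\mathbf{x}-\mathbf{p}\|\right),$$ where $q$ runs over positive integers. The $d$-dimensional Lagrange spectrum with respect to $\|\cdot\|$ is $\mathcal{L}_{d}(\|\cdot\|):=\{\Theta_{d}(\mathbf{x},\|\cdot\|): \mathbf{x}\in\mathbb{R}^{d}\}$. Here $\mathbb{R}_+$ denotes the positive reals and $\dim_H$ denotes Hausdorff dimension. *)

(* Defs.v *)
From HB Require Import structures.
From mathcomp Require Import all_boot all_order all_algebra.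
From mathcomp Require Import all_classical all_reals all_analysis.
From mathcomp Require Import ring lra.
Set Implicit Arguments.
Unset Strict Implicit.
Unset Printing Implicit Defensive.
Import Order.TTheory GRing.Theory Num.Theory.
Import numFieldNormedType.Exports.

Local Open Scope classical_set_scope.
Local Open Scope ring_scope.

(* The library's own norm on 'rV[R]_d is the sup norm. *)
Definition euclidean_norm (R : realType) (d : nat) (v : 'rV[R]_d) : R :=
  Num.sqrt (\sum_(i < d) v 0 i ^+ 2).

(* For a norm N the infimum is attained, hence it is the minimum over p in Z^d;
   [dist_int_euclidean_attained] checks this for the Euclidean norm. *)
Definition dist_int (R : realType) (d : nat) (N : 'rV[R]_d -> R)
    (v : 'rV[R]_d) : R :=
  inf [set N (v - map_mx intr p) | p in [set: 'rV[int]_d]].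

(* The liminf is taken in the extended reals, so that no boundedness side
   condition is needed; by Dirichlet's theorem its value is finite. *)
Definition Theta (R : realType) (d : nat) (N : 'rV[R]_d -> R)
    (x : 'rV[R]_d) : \bar R :=
  limn_einf (fun n : nat =>
    (n.+1%:R `^ d%:R^-1 * dist_int N (n.+1%:R *: x))%:E).

Definition lagrange_spectrum (R : realType) (d : nat) (N : 'rV[R]_d -> R) :
    set (\bar R) :=
  range (Theta N).

(* The point 0 is added so that the empty set has diameter 0. *)
Definition diameter (R : realType) (d : nat) (A : set 'rV[R]_d) : \bar R :=
  ereal_sup ([set 0%E] `|`
    [set (euclidean_norm (xy.1 - xy.2))%:E | xy in A `*` A]).

(* (diam A)^s, with the usual convention that the empty set contributes 0
   even when s = 0. *)
Definition diameter_pow (R : realType) (d : nat) (s : R)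
    (A : set 'rV[R]_d) : \bar R :=
  if A == set0 then 0%E else (diameter A `^ s)%E.

Definition hausdorff_premeasure (R : realType) (d : nat) (s r : R)
    (A : set 'rV[R]_d) : \bar R :=
  ereal_inf [set (\sum_(0 <= i <oo) diameter_pow s (U i))%E |
    U in [set U : nat -> set 'rV[R]_d |
      A `<=` \bigcup_i U i /\ forall i, (diameter (U i) <= r%:E)%E]].

Definition hausdorff_measure (R : realType) (d : nat) (s : R)
    (A : set 'rV[R]_d) : \bar R :=
  ereal_sup [set hausdorff_premeasure s r A | r in [set r : R | 0 < r]].

Definition hausdorff_dim (R : realType) (d : nat) (A : set 'rV[R]_d) : \bar R :=
  ereal_inf [set s%:E | s in [set s : R | 0 <= s /\ hausdorff_measure s A = 0%E]].

Lemma dist_int_euclidean_attained (R : realType) (d : nat) (v : 'rV[R]_d) :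
  exists p : 'rV[int]_d,
    dist_int (@euclidean_norm R d) v = euclidean_norm (v - map_mx intr p).
Proof.
pose p : 'rV[int]_d := \row_i Num.floor (v 0 i + 2^-1).
exists p; rewrite /dist_int.
set S := [set _ | _ in _].
have Sp : S (euclidean_norm (v - map_mx intr p)) by exists p.
have lbp : lbound S (euclidean_norm (v - map_mx intr p)).
  move=> _ [q _ <-]; rewrite /euclidean_norm ler_wsqrtr//.
  apply: ler_sum => i _; rewrite !mxE.
  set t := v 0 i; set f := Num.floor _.
  have /andP[lef ltf] : f%:~R <= t + 2^-1 < (f + 1)%:~R.
    by rewrite floor_le ?floorD1_gt.
  rewrite intrD in ltf.
  have hf : `|t - f%:~R| <= 2^-1.
    by rewrite ler_norml; apply/andP; split; lra.
  rewrite -(real_normK (num_real (t - f%:~R))) -(real_normK (num_real (t - (q 0 i)%:~R))).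
  have [->//|neq] := eqVneq (q 0 i) f.
  rewrite lerXn2r ?nnegrE//.
  apply: (le_trans hf).
  have : 1 <= `|(q 0 i)%:~R - f%:~R : R|.
    by rewrite -intrB -intr_norm ler1z -gtz0_ge1 normr_gt0 subr_eq0.
  have -> : (q 0 i)%:~R - f%:~R = (t - f%:~R) - (t - (q 0 i)%:~R) :> R by ring.
  move=> /le_trans/(_ (ler_normB _ _)); lra.
by apply/eqP; rewrite eq_le ge_inf ?lb_le_inf//; exists (euclidean_norm (v - map_mx intr p)).
Qed.

(* Main.v *)
(* Among the b^d subcubes of side h/b of a cube of side h, all but a fraction
   O(1/b) stay away from the rationals p/q whose denominator has the size
   corresponding to h, since these rationals lie on one hyperplane by the
   simplex lemma.  Iterating gives a Cantor set of badly approximable points of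
   dimension close to d, with a constant e1 depending on b only.

   For e much smaller than e1 the construction is interrupted at sparse scales
   to hit the shell e <= q^(1/d) |q y - p| <= e (1 + e^d) of some p/q.  Take a
   point x of the cube that is e1-badly approximable, a Dirichlet approximation
   p/q of x, and the point xs of the segment from p/q to x lying in the shell.
   If some other p'/q' were too close to xs, then a suitable integral
   combination j (q', p') - k (q, p) with j as in Dirichlet's theorem would be
   too close to x.  Hence a small cube around xs lies in the shell and can be
   used to continue the construction.  The number of scales lost is bounded in
   terms of e, so that the dimension of the Cantor set does not suffer.

   The lower bound for the dimension is proved without a measure: given a cover
   of small total weight, one descends into subcubes met by as little weight as
   possible, and the limit point is covered by none of the sets. *)
From HB Require Import structures.
From mathcomp Require Import all_boot all_order all_fingroup all_algebra.
From mathcomp Require Import all_classical all_reals all_analysis.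
From mathcomp Require Import ring lra zify.
Require Import Defs.
Set Implicit Arguments.
Unset Strict Implicit.
Unset Printing Implicit Defensive.
Import Order.TTheory GRing.Theory Num.Theory.
Import numFieldNormedType.Exports.

Local Open Scope classical_set_scope.
Local Open Scope ring_scope.

(** * Euclidean norm and determinants *)

(** The exponent in the width [e^d] of the shell comes from the handover between two arguments. In a
    cube of side [T], subdivision by the simplex lemma reaches only denominators with [q'^(1+1/d)]
    at least [b e / T]. Smaller ones must be kept away by the separation of [xs] from other
    rationals, which works up to [q' = (c/e)^d q]. So [T] is about [e / ((c/e)^(d+1) q^(1+1/d))],
    and within such a cube [q^(1/d) |q y - p|] varies by about [e^(d+2) / c^(d+1)]. This is below
    [e^(d+1)] with one power of [e] to spare, which absorbs all constants; hence [delta = 1]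
    suffices, and [Delta] only has to be at least 1. The condition [d >= 2] enters in the
    separation: for a pigeonhole of size [J], the combination [(Q, P)] has denominator of order
    [J q] and error of order [1 / (J q^(1/d))], so [Q |Q x - P|^d] gains a factor [J^(1-d)]. *)

Section EuclideanNorm.
Variables (R : realType) (d : nat).
Implicit Types u v : 'rV[R]_d.
Local Notation N := (@euclidean_norm R d).

Lemma enorm_ge0 v : 0 <= N v.
Proof. exact: sqrtr_ge0. Qed.

Lemma enorm_sqr v : N v ^+ 2 = \sum_(i < d) v 0 i ^+ 2.
Proof. by rewrite sqr_sqrtr// sumr_ge0// => i _; rewrite sqr_ge0. Qed.

Lemma enormZ a v : N (a *: v) = `|a| * N v.
Proof.
rewrite /euclidean_norm -sqrtr_sqr -sqrtrM ?sqr_ge0// mulr_sumr; congr Num.sqrt.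
by apply: eq_bigr => i _; rewrite mxE exprMn.
Qed.

Lemma enormN v : N (- v) = N v.
Proof. by rewrite -scaleN1r enormZ normrN1 mul1r. Qed.

Lemma enorm_cauchy u v : \sum_(i < d) u 0 i * v 0 i <= N u * N v.
Proof.
apply: ler_normlW; rewrite -(ler_pXn2r (n := 2)) ?nnegrE ?mulr_ge0 ?enorm_ge0//.
rewrite real_normK ?num_real// exprMn !enorm_sqr -subr_ge0.
set S := _ - _; suff -> : S = 2^-1 * \sum_(i < d) \sum_(j < d)
    (u 0 i * v 0 j - u 0 j * v 0 i) ^+ 2.
  rewrite mulr_ge0// ?invr_ge0//.
  by apply: sumr_ge0 => i _; apply: sumr_ge0 => j _; rewrite sqr_ge0.
have -> : \sum_(i < d) \sum_(j < d) (u 0 i * v 0 j - u 0 j * v 0 i) ^+ 2 =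
   (\sum_(i < d) u 0 i ^+ 2) * (\sum_(i < d) v 0 i ^+ 2) +
   (\sum_(i < d) v 0 i ^+ 2) * (\sum_(i < d) u 0 i ^+ 2)
   - 2 * ((\sum_(i < d) u 0 i * v 0 i) * (\sum_(i < d) u 0 i * v 0 i)).
  rewrite !big_distrlr mulr_sumr -sumrN -!big_split/=.
  apply: eq_bigr => i _; rewrite mulr_sumr -sumrN -!big_split/=.
  by apply: eq_bigr => j _; ring.
by rewrite /S; field.
Qed.

Lemma enormD u v : N (u + v) <= N u + N v.
Proof.
rewrite -(ler_pXn2r (n := 2)) ?nnegrE ?addr_ge0 ?enorm_ge0// sqrrD !enorm_sqr.
have -> : \sum_(i < d) (u + v) 0 i ^+ 2 =
    \sum_(i < d) u 0 i ^+ 2 + 2 * (\sum_(i < d) u 0 i * v 0 i)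
    + \sum_(i < d) v 0 i ^+ 2.
  by rewrite mulr_sumr -!big_split/=; apply: eq_bigr => i _; rewrite mxE; ring.
by have := enorm_cauchy u v; lra.
Qed.

Lemma enorm_coord v i : `|v 0 i| <= N v.
Proof.
rewrite -(ler_pXn2r (n := 2)) ?nnegrE ?enorm_ge0// real_normK ?num_real//.
by rewrite enorm_sqr (bigD1 i)//= lerDl sumr_ge0// => j _; rewrite sqr_ge0.
Qed.

Lemma enorm_le v c : 0 <= c -> (forall i, `|v 0 i| <= c) -> N v <= d%:R * c.
Proof.
move=> c0 vc; rewrite -(ler_pXn2r (n := 2)) ?nnegrE ?enorm_ge0 ?mulr_ge0//.
rewrite enorm_sqr (@le_trans _ _ (\sum_(i < d) c ^+ 2))//.
  apply: ler_sum => i _; rewrite -(real_normK (num_real (v 0 i))).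
  by rewrite lerXn2r ?nnegrE.
rewrite sumr_const card_ord exprMn -[leLHS]mulr_natl; apply: ler_wpM2r.
  by rewrite sqr_ge0.
by rewrite -natrX ler_nat; case: (d) => // k; rewrite -[leqLHS]expn1 leq_pexp2l.
Qed.

Lemma enorm_int_ge1 (p : 'rV[int]_d) : p != 0 -> 1 <= N (map_mx intr p).
Proof.
case/rV0Pn => i pi0; apply: le_trans (enorm_coord _ i).
by rewrite mxE -intr_norm ler1z -gtz0_ge1 normr_gt0.
Qed.

End EuclideanNorm.

Section Determinants.
Variable R : realType.

(** A linearly independent family in [P] of maximal size has fewer than [n] members and spans all of
    [P]; a nonzero column of its cokernel serves as [w]. *)
Lemma common_hyperplane n (P : 'rV[R]_n -> Prop) :
  (forall A : 'M[R]_n, (forall i, P (row i A)) -> \det A = 0) ->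
  exists2 w : 'cV[R]_n, w != 0 & forall v, P v -> v *m w = 0.
Proof.
move=> detP.
pose Q k := `[< exists A : 'M[R]_(k, n), (forall i, P (row i A)) /\ row_free A >].
have Q0 : exists k, Q k.
  exists 0%N; apply/asboolP; exists 0; split; first by case.
  by rewrite /row_free mxrank0.
have Qn k : Q k -> (k <= n)%N.
  by case/asboolP => A [_ /eqP <-]; exact: rank_leq_col.
case: (ex_maxnP Q0 Qn) => k /asboolP [A [PA fA]] maxk.
have kn : (k < n)%N.
  rewrite ltn_neqAle Qn ?andbT; last by apply/asboolP; exists A.
  apply/eqP => kn; move: A PA fA; rewrite kn => A PA.
  by rewrite row_free_unit unitmxE detP// unitr0.
have : cokermx A != 0.
  by rewrite -mxrank_eq0 mxrank_coker (eqP fA) subn_eq0 -ltnNge.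
case/matrix0Pn => i [j cij]; exists (col j (cokermx A)).
  by apply/matrix0Pn; exists i, 0; rewrite mxE.
move=> v Pv.
suff /submxP [B ->] : (v <= A)%MS.
  by rewrite -mulmxA colE 2!mulmxA -(mulmxA B) mulmx_coker mulmx0 mul0mx.
apply: contraPT isT => vA; have : Q k.+1.
  apply/asboolP; rewrite -addn1; exists (col_mx A v); split.
    move=> l; case: (split_ordP l) => m ->.
      by rewrite rowKu.
    by rewrite rowKd (_ : row m v = v)//; apply/rowP => ?; rewrite mxE (ord1 m).
  rewrite /row_free eqn_leq rank_leq_row/=.
  have : (A < A + v)%MS.
    rewrite ltmxE addsmxSl/=; apply: contra vA; apply: submx_trans.
    exact: addsmxSr.
  by rewrite ltmxErank => /andP[_]; rewrite (eqP fA) -addsmxE addn1.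
by move=> /maxk; rewrite ltnn.
Qed.

Lemma det_col_bound n (A : 'M[R]_n) (c : 'I_n -> R) :
  (forall i j, `|A i j| <= c j) -> `|\det A| <= (n`!)%:R * \prod_j c j.
Proof.
move=> Ac; rewrite /determinant.
apply: le_trans (ler_norm_sum _ _ _) _.
apply: (@le_trans _ _ (\sum_(s : 'S_n) \prod_j c j)); last first.
  by rewrite sumr_const card_Sn mulr_natl.
apply: ler_sum => s _; rewrite normrM normrX normrN1 expr1n mul1r normr_prod.
rewrite [leRHS](reindex_inj (@perm_inj _ s))/=.
by apply: ler_prod => i _; rewrite normr_ge0 Ac.
Qed.

Lemma det_int_ge1 n (A : 'M[int]_n) :
  \det (map_mx intr A : 'M[R]_n) != 0 -> 1 <= `|\det (map_mx intr A : 'M[R]_n)|.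
Proof.
by rewrite det_map_mx intr_eq0 -intr_norm ler1z -gtz0_ge1 normr_gt0.
Qed.

End Determinants.

(** * Cubes and the simplex lemma *)

Section Counting.
Local Open Scope set_scope.

Definition set_coord (I A : finType) (f : {ffun I -> A}) i0 t :=
  [ffun i => if i == i0 then t else f i].

(** Double counting of the pairs [(f, t)] with [set_coord f i0 t] in [S]: each element of [S] arises
    from [#|A|] of them, since the coordinate [i0] of [f] is overwritten. *)
Lemma card_fibers_le (I A : finType) (S : {set {ffun I -> A}}) (i0 : I) m :
  (forall f, #|[set t | set_coord f i0 t \in S]| <= m)%N ->
  (#|S| * #|A| <= m * #|A| ^ #|I|)%N.
Proof.
move=> Sm.
pose T := [set ft : {ffun I -> A} * A | set_coord ft.1 i0 ft.2 \in S].
pose phi (sv : {ffun I -> A} * A) := (set_coord sv.1 i0 sv.2, sv.1 i0).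
have phiK (s : {ffun I -> A}) (v : A) : set_coord (set_coord s i0 v) i0 (s i0) = s.
  by apply/ffunP => i; rewrite !ffunE; case: eqP => // ->.
have phi_inj : injective phi.
  move=> [s v] [s' v'] [E1 E2]; have <- : s = s'.
    by rewrite -(phiK s v) E1 E2 phiK.
  by move/ffunP: E1 => /(_ i0); rewrite !ffunE eqxx => ->.
rewrite -cardsT -cardsX -(card_imset _ phi_inj).
apply: (@leq_trans #|T|).
  apply/subset_leq_card/fintype.subsetP => _ /imsetP[[s v] /setXP[/= Ss _] ->].
  by rewrite inE/= phiK.
rewrite -sum1_card.
have -> : (\sum_(i in T) 1 =
    \sum_(f : {ffun I -> A}) \sum_(t | set_coord f i0 t \in S) 1)%N.
  by rewrite pair_big_dep/=; apply: eq_bigl => ft; rewrite inE.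
rewrite cardsT -(card_ffun I A) mulnC -sum_nat_const.
by apply: leq_sum => f _; apply: leq_trans (Sm f); rewrite -sum1dep_card.
Qed.

Lemma card_ord_near (R : realType) b (S : {set 'I_b}) (g : R) m :
  (forall t, t \in S -> `|t%:R - g| <= m%:R) -> (#|S| <= (2 * m).+1)%N.
Proof.
move=> Sg; case: (set_0Vmem S) => [->|[t1 t1S]]; first by rewrite cards0.
case: (arg_minnP (fun t : 'I_b => t : nat) t1S) => t0 t0S t0min.
pose f (t : 'I_b) : 'I_(2 * m).+1 := inord (t - t0).
have lef t : t \in S -> (t - t0 < (2 * m).+1)%N.
  move=> tS; rewrite ltnS -(ler_nat R) natrB ?t0min// natrM.
  by move: (Sg _ tS) (Sg _ t0S); rewrite !ler_norml => /andP[? ?] /andP[? ?]; lra.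
rewrite -(card_ord (2 * m).+1) -(@card_in_imset _ _ f) ?max_card//.
move=> t t' tS t'S /(congr1 (@nat_of_ord _)); rewrite /f !inordK ?lef// => E.
by apply: val_inj; have := t0min _ tS; have := t0min _ t'S; simpl; lia.
Qed.

End Counting.

Section Cubes.
Variables (R : realType) (d : nat).
Local Notation N := (@euclidean_norm R d).

Definition cube (a : 'rV[R]_d) (h : R) : set 'rV[R]_d :=
  [set x | forall i, a 0 i <= x 0 i <= a 0 i + h].

Definition child (b : nat) (a : 'rV[R]_d) (h : R) (c : {ffun 'I_d -> 'I_b}) :
    'rV[R]_d :=
  \row_i (a 0 i + h / b%:R * (c i)%:R).

(* The d-th power of [e <= q^(1/d) |q x - p|], which avoids roots. *)
Definition avoid (e : R) (q : nat) (x : 'rV[R]_d) :=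
  forall p : 'rV[int]_d, e ^+ d <= q%:R * N (q%:R *: x - map_mx intr p) ^+ d.

Lemma cube_child b a h c : (0 < b)%N -> 0 <= h ->
  cube (@child b a h c) (h / b%:R) `<=` cube a h.
Proof.
move=> b0 h0 x xc i; have /andP[] := xc i; rewrite mxE.
have b0' : 0 < b%:R :> R by rewrite ltr0n.
have c1 : (c i)%:R + 1 <= b%:R :> R by rewrite natr1 ler_nat.
have hb : 0 <= h / b%:R by rewrite divr_ge0// ltW.
have : h / b%:R * (c i)%:R + h / b%:R <= h.
  rewrite -[X in _ + X]mulr1 -mulrDr; apply: le_trans (ler_wpM2l hb c1) _.
  by rewrite divfK// gt_eqF.
have : 0 <= h / b%:R * (c i)%:R by rewrite mulr_ge0.
by move=> *; apply/andP; split; lra.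
Qed.

(* Simplex lemma: d + 1 affinely independent rationals with denominators at
   most Q span a simplex of volume at least 1 / (d! Q^(d+1)). *)
Lemma rationals_on_hyperplane (a : 'rV[R]_d) (t : R)
    (P : nat -> 'rV[int]_d -> Prop) : (0 < d)%N -> 0 <= t ->
  (forall q p, P q p -> (forall i, `|(p 0 i)%:~R - q%:R * a 0 i| <= q%:R * t) /\
     q%:R ^+ d.+1 * ((d.+1)`!%:R * t) ^+ d < 1) ->
  exists (w : 'rV[R]_d) (w0 : R), (w != 0 \/ w0 != 0) /\
    forall q p, P q p -> \sum_i w 0 i * (p 0 i)%:~R + w0 * q%:R = 0.
Proof.
move=> d0 t0 HP.
pose vec (q : nat) (p : 'rV[int]_d) : 'rV[int]_(d + 1) := row_mx p (q%:Z)%:M.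
pose P' (v : 'rV[R]_(d + 1)) := exists q p, P q p /\ v = map_mx intr (vec q p).
have [|w w0 Hw] := @common_hyperplane R (d + 1) P'.
  move=> A PA.
  have /boolp.choice[f Hf] : forall i, exists f : nat * 'rV[int]_d,
      P f.1 f.2 /\ row i A = map_mx intr (vec f.1 f.2).
    by move=> i; have [q [p ?]] := PA i; exists (q, p).
  pose Z : 'M[int]_(d + 1) := \matrix_i vec (f i).1 (f i).2.
  have AZ : A = map_mx intr Z.
    apply/row_matrixP => i; rewrite (Hf i).2; apply/rowP => j.
    by rewrite !mxE.
  apply/eqP; apply: contraT => detA; exfalso.
  have := @det_int_ge1 R _ Z; rewrite -AZ => /(_ detA).
  (* A shear turns each row [(p, q)] into [(p - q a, q)] without changing the determinant, so that
     all columns but the last become small. *)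
  pose M : 'M[R]_(d + 1) := block_mx 1%:M 0 (- a) 1%:M.
  have detM : \det M = 1 by rewrite det_lblock !det1 mulr1.
  have -> : \det A = \det (A *m M) by rewrite det_mulmx detM mulr1.
  pose Q := (\max_i (f i).1)%N.
  pose c (j : 'I_(d + 1)) : R := if fintype.split j is inl _ then Q%:R * t else Q%:R.
  have splitr k : fintype.split (rshift d k : 'I_(d + 1)) = inr k := unsplitK (inr k).
  have splitl k : fintype.split (lshift 1 k) = inl k := unsplitK (inl k).
  have bnd i j : `|(A *m M) i j| <= c j.
    have -> : (A *m M) i j = (row i A *m M) 0 j by rewrite -row_mul [RHS]mxE.
    have fQ : ((f i).1%:R : R) <= Q%:R by rewrite ler_nat; exact: leq_bigmax.
    rewrite (Hf i).2 map_row_mx mul_row_block /c.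
    case: (split_ordP j) => k ->; last first.
      rewrite ?splitr row_mxEr mulmx0 add0r mulmx1 !mxE (ord1 k) eqxx.
      by rewrite mulr1n ger0_norm// ler0n.
    rewrite ?splitl row_mxEl mulmx1 !mxE big_ord1 !mxE mulr1n mulrN.
    apply: le_trans ((HP _ _ (Hf i).1).1 k) _.
    by rewrite ler_wpM2r.
  (* The largest denominator belongs to one of the rows, so the size hypothesis applies to it. *)
  have [i0 Qi0] : exists i0, Q = (f i0).1.
    have : (0 < #|{: 'I_(d + 1)}|)%N by rewrite card_ord addn1.
    by move=> /(@bigop.eq_bigmax _ (fun i => (f i).1)) [i0 ?]; exists i0.
  have := (HP _ _ (Hf i0).1).2; rewrite -Qi0 => Qlt /le_trans/(_ (det_col_bound bnd)).
  rewrite leNgt => /negP; apply; apply: le_lt_trans Qlt.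
  rewrite big_split_ord/= big_ord1 /c splitr.
  under eq_bigr do rewrite splitl.
  rewrite prodr_const card_ord !exprMn exprS addn1.
  have F1 : ((d.+1)`!%:R : R) <= (d.+1)`!%:R ^+ d.
    by rewrite -natrX ler_nat -[leqLHS]expn1 leq_pexp2l// fact_gt0.
  have : 0 <= Q%:R * Q%:R ^+ d * t ^+ d by rewrite !mulr_ge0// exprn_ge0.
  move=> /ler_wpM2r/(_ _ _ F1) F2.
  rewrite [leLHS](_ : _ = (d.+1)`!%:R * (Q%:R * Q%:R ^+ d * t ^+ d)); last by ring.
  by apply: le_trans F2 _; rewrite le_eqVlt; apply/orP; left; apply/eqP; ring.
exists (\row_i w (lshift 1 i) 0), (w (rshift d 0) 0); split.
  case/matrix0Pn: w0 => i [j]; rewrite (ord1 j).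
  case: (split_ordP i) => k ->.
    by move=> wk; left; apply/rV0Pn; exists k; rewrite mxE.
  by rewrite (ord1 k); right.
move=> q p Pqp; have := Hw _ (ex_intro _ q (ex_intro _ p (conj Pqp erefl))).
move=> /matrixP/(_ 0 0); rewrite !mxE big_split_ord/= big_ord1; apply: etrans.
congr (_ + _).
  by apply: eq_bigr => i _; rewrite /vec map_row_mx row_mxEl !mxE mulrC.
by rewrite /vec map_row_mx row_mxEr !mxE eqxx mulr1n mulrC.
Qed.

End Cubes.

Section Step.
Variables (R : realType) (d : nat).
Local Notation N := (@euclidean_norm R d).

(** Chosen so that [simplex_const b * (h / b)] equals [(d+1)! * (2 h)], the quantity in
    [rationals_on_hyperplane] for [t = 2 h]. *)
Definition simplex_const (b : nat) : R := 2 * b%:R * (d.+1)`!%:R.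

(** The first inequality is [e / q^(1+1/d) <= g] without roots: a rational that obstructs [x] is
    within [g] of it. *)
Lemma dist_lt_of_not_avoid (e g : R) (q : nat) (x : 'rV[R]_d) (p : 'rV[int]_d) :
  0 <= g -> e ^+ d <= g ^+ d * q%:R ^+ d.+1 ->
  q%:R * N (q%:R *: x - map_mx intr p) ^+ d < e ^+ d ->
  (0 < q)%N /\ forall i, `|q%:R * x 0 i - (p 0 i)%:~R| <= q%:R * g.
Proof.
move=> g0 eg qN; have := lt_le_trans qN eg.
have -> : g ^+ d * q%:R ^+ d.+1 = q%:R * (q%:R * g) ^+ d :> R.
  by rewrite exprMn exprS; ring.
have [->|q0] := posnP q; first by rewrite !mul0r ltxx.
rewrite ltr_pM2l ?ltr0n// => H; split=> // i.
have := enorm_coord (q%:R *: x - map_mx intr p) i; rewrite !mxE => /le_trans; apply.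
rewrite leNgt; apply/negP => H'; move: H; rewrite ltNge => /negP; apply.
by rewrite lerXn2r ?nnegrE ?mulr_ge0 ?enorm_ge0// ltW.
Qed.

(* All rationals obstructing the cube lie on one hyperplane, which meets at
   most 4 d + 1 subcubes in each column along its steepest coordinate. *)
Lemma most_children_avoid (b : nat) (a : 'rV[R]_d) (h e : R) :
  (0 < d)%N -> (2 <= b)%N -> 0 < h ->
  exists S : {set {ffun 'I_d -> 'I_b}},
    (#|~: S| * b <= (4 * d).+1 * b ^ d)%N /\
    forall c, c \in S -> forall x, cube (child a h c) (h / b%:R) x ->
      forall q, e ^+ d <= (h / b%:R) ^+ d * q%:R ^+ d.+1 ->
        q%:R ^+ d.+1 * (simplex_const b * (h / b%:R)) ^+ d < 1 -> avoid e q x.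
Proof.
move=> d0 b2 h0.
have b0 : 0 < b%:R :> R by rewrite ltr0n; lia.
set g := h / b%:R; have g0 : 0 < g by rewrite divr_gt0.
have gb : g * b%:R = h by rewrite /g divfK// gt_eqF.
pose bad (x : 'rV[R]_d) (q : nat) (p : 'rV[int]_d) :=
  [/\ e ^+ d <= g ^+ d * q%:R ^+ d.+1,
      q%:R ^+ d.+1 * (simplex_const b * g) ^+ d < 1 &
      q%:R * N (q%:R *: x - map_mx intr p) ^+ d < e ^+ d].
pose P (q : nat) (p : 'rV[int]_d) := exists2 x, cube a h x & bad x q p.
pose S : {set {ffun 'I_d -> 'I_b}} :=
  finset (fun c => ~~ `[< exists2 x, cube (child a h c) g x & exists q p, bad x q p >]).
exists S; split; last first.
  move=> c; rewrite inE => /asboolP cS x xc q q1 q2 p.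
  by rewrite leNgt; apply/negP => q3; apply: cS; exists x => //; exists q, p.
have [-> |[c0]] := set_0Vmem (~: S); first by rewrite cards0.
have cSP c : c \in ~: S ->
    exists2 x, cube (child a h c) g x & exists q p, bad x q p /\ P q p.
  rewrite !inE negbK => /asboolP [x xc [q [p B]]]; exists x => //; exists q, p.
  split=> //; exists x => //; apply: cube_child xc; last exact: ltW.
  by lia.
(* A rational obstructing a point of the cube is within [g] of that point, hence in the cube with
   corner [a - g] and side [h + 2 g <= 2 h], as [b >= 2]. *)
have [|q p [x xa [B1 B2 B3]]|w [w0 [wn0 wP]]] :=
  @rationals_on_hyperplane R d (\row_i (a 0 i - g)) (2 * h) P d0.
- by rewrite mulr_ge0// ltW.
- split; last first.
    apply: le_lt_trans B2; rewrite le_eqVlt; apply/orP; left; apply/eqP.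
    by congr (_ * _ ^+ _); rewrite /simplex_const -gb; ring.
  have [q0 H] := dist_lt_of_not_avoid (ltW g0) B1 B3.
  have qh : q%:R * (2 * g) <= q%:R * h.
    by rewrite ler_wpM2l// -gb mulrC ler_wpM2l ?(ltW g0)// (ler_nat R 2).
  move=> i; rewrite mxE; have := H i; have /andP[] := xa i.
  move=> /(ler_wpM2l (ler0n R q)) X1 /(ler_wpM2l (ler0n R q)) X2.
  move: X1 X2; rewrite !ler_norml => X1 X2 /andP[X3 X4].
  have : 0 < q%:R * g by rewrite mulr_gt0// ltr0n.
  have : 0 < q%:R * h by rewrite mulr_gt0// ltr0n.
  rewrite !(mulrDr, mulrN, mulrBr) in X1 X2 X3 X4 qh *.
  by move=> *; apply/andP; split; lra.
move=> c0S; have {}wn0 : w != 0.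
  case: wn0 => // w0n0; apply/negP => /eqP w_eq0.
  have [x xc [q [p [B Pqp]]]] := cSP _ c0S; have := wP _ _ Pqp.
  rewrite w_eq0 big1 ?add0r => [/eqP|i _]; last by rewrite mxE mul0r.
  case: B => B1 _ B3; have [q0 _] := dist_lt_of_not_avoid (ltW g0) B1 B3.
  by rewrite mulf_eq0 (negbTE w0n0)/= pnatr_eq0 -leqn0 leqNgt q0.
case/rV0Pn: wn0 => i1 wi1.
have [i0 _ wmax] := Order.TotalTheory.arg_maxP (fun i => `|w 0 i|) (erefl true : (fun _ => true) i1).
have wi0 : 0 < `|w 0 i0| by apply: lt_le_trans (wmax i1 _); rewrite ?normr_gt0.
have wi0n : w 0 i0 != 0 by rewrite -normr_gt0.
rewrite -[X in (_ * X <= _)%N](card_ord b) -[X in (_ <= _ * X ^ _)%N](card_ord b).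
rewrite -[X in (_ <= _ * _ ^ X)%N](card_ord d).
apply: (@card_fibers_le _ _ _ i0) => f.
(* The affine form of the hyperplane takes the value [w 0 i0 * g * (t + G)] at the corner of the
   subcube. In an obstructed subcube it is at most [d * |w 0 i0| * g] at some point, and it changes
   by at most as much between this point and the corner. So [t] is within [2 d] of [- G], which
   leaves [4 d + 1] values. *)
pose G := (\sum_(i | i != i0) w 0 i * (a 0 i + g * (f i)%:R) + w 0 i0 * a 0 i0 + w0)
            / (w 0 i0 * g).
rewrite (_ : (4 * d = 2 * (2 * d))%N); last by lia.
apply: (@card_ord_near R _ _ (- G)) => t; rewrite inE => /cSP [x xc [q [p [B Pqp]]]].
case: B => B1 B2 B3; have [q0 H] := dist_lt_of_not_avoid (ltW g0) B1 B3.
have q0' : 0 < q%:R :> R by rewrite ltr0n.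
set c := set_coord f i0 t in xc.
have E1 : `|\sum_i w 0 i * x 0 i + w0| <= d%:R * (`|w 0 i0| * g).
  rewrite -(ler_pM2l q0') -[q%:R in leLHS]gtr0_norm// -normrM.
  have -> : q%:R * (\sum_i w 0 i * x 0 i + w0) =
      \sum_i w 0 i * (q%:R * x 0 i - (p 0 i)%:~R).
    transitivity (q%:R * (\sum_i w 0 i * x 0 i + w0)
      - (\sum_i w 0 i * (p 0 i)%:~R + w0 * q%:R)); first by rewrite (wP _ _ Pqp) subr0.
    rewrite mulrDr mulr_sumr opprD addrACA -sumrB -[RHS]addr0.
    by congr (_ + _); [apply: eq_bigr => i _; ring | ring].
  apply: le_trans (ler_norm_sum _ _ _) _.
  rewrite -[X in X%:R * _](card_ord d) mulrCA mulr_natl -sumr_const.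
  apply: ler_sum => i _; rewrite normrM mulrCA.
  by apply: ler_pM => //; apply: wmax.
have E2 : `|\sum_i w 0 i * (child a h c) 0 i - \sum_i w 0 i * x 0 i| <= d%:R * (`|w 0 i0| * g).
  rewrite -sumrB; apply: le_trans (ler_norm_sum _ _ _) _.
  rewrite -[X in X%:R * _](card_ord d) mulr_natl -sumr_const.
  apply: ler_sum => i _; rewrite -mulrBr normrM.
  apply: ler_pM => //; first exact: wmax.
  by rewrite ler_norml; have /andP[? ?] := xc i; apply/andP; split; lra.
have E3 : \sum_i w 0 i * (child a h c) 0 i + w0 = (w 0 i0 * g) * (t%:R + G).
  have -> : w 0 i0 * g * (t%:R + G) = w 0 i0 * g * t%:R +
      (\sum_(i | i != i0) w 0 i * (a 0 i + g * (f i)%:R) + w 0 i0 * a 0 i0 + w0).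
    by rewrite mulrDr; congr (_ + _); rewrite /G mulrC divfK// mulf_neq0// gt_eqF.
  rewrite (bigD1 i0)//= !mxE !ffunE eqxx -/g.
  have -> : \sum_(i < d | i != i0) w 0 i * child a h c 0 i =
     \sum_(i < d | i != i0) w 0 i * (a 0 i + g * (f i)%:R).
    by apply: eq_bigr => i /negbTE ii0; rewrite mxE ffunE ii0.
  by ring.
have : `|(w 0 i0 * g) * (t%:R + G)| <= 2 * (d%:R * (`|w 0 i0| * g)).
  rewrite -E3; have -> : \sum_i w 0 i * child a h c 0 i + w0 =
    (\sum_i w 0 i * x 0 i + w0) +
    (\sum_i w 0 i * child a h c 0 i - \sum_i w 0 i * x 0 i) by ring.
  by apply: le_trans (ler_normD _ _) _; lra.
rewrite normrM [X in X * _]normrM (gtr0_norm g0) opprK natrM.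
rewrite [leRHS](_ : _ = `|w 0 i0| * g * (2 * d%:R)); last by ring.
by rewrite ler_pM2l// mulr_gt0.
Qed.

End Step.

(** * Approximation by rationals *)

Section Dirichlet.
Variable R : realType.

Lemma dirichlet_approximation (d n : nat) (x : 'rV[R]_d) : (0 < n)%N ->
  exists (q : nat) (p : 'rV[int]_d), (0 < q <= n ^ d)%N /\
    forall i, `|q%:R * x 0 i - (p 0 i)%:~R| <= n%:R^-1.
Proof.
case: n => // n _.
have n0 : 0 < n.+1%:R :> R by rewrite ltr0n.
pose fr (k : nat) (i : 'I_d) : R := k%:R * x 0 i - (Num.floor (k%:R * x 0 i))%:~R.
have fr0 k i : 0 <= n.+1%:R * fr k i < n.+1%:R.
  have := floor_itv (k%:R * x 0 i); rewrite intrD /fr => /andP[H1 H2].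
  by rewrite mulr_ge0 ?subr_ge0//= -[ltRHS]mulr1 ltr_pM2l// ltrBlDl.
pose f (k : 'I_(n.+1 ^ d).+1) : {ffun 'I_d -> 'I_n.+1} :=
  [ffun i => inord (Num.truncn (n.+1%:R * fr k i))].
have /injectivePn [k1 [k2 k12 fk]] : ~~ injectiveb f.
  apply/negP => /injectiveP /leq_card; rewrite card_ord card_ffun !card_ord.
  by rewrite ltnn.
have key k i : exists2 t : nat, f k i = t :> nat & t%:R <= n.+1%:R * fr k i < t%:R + 1.
  exists (Num.truncn (n.+1%:R * fr k i)); last by rewrite natr1 truncn_itv//; case/andP: (fr0 k i).
  rewrite ffunE inordK// ltnS; case/andP: (fr0 k i) => h1 h2.
  rewrite -ltnS -(ltr_nat R); apply: le_lt_trans h2.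
  by case/andP: (truncn_itv h1).
wlog lt12 : k1 k2 k12 fk / (k1 < k2)%N.
  move=> W; case: (ltngtP k1 k2) => [||E]; [exact: W|move=> H|].
    by apply: (W k2 k1) => //; rewrite eq_sym.
  by move/eqP: k12; case; apply: val_inj.
exists (k2 - k1)%N, (\row_i (Num.floor (k2%:R * x 0 i) - Num.floor (k1%:R * x 0 i))).
split; first by rewrite subn_gt0 lt12/= leq_subLR; have := ltn_ord k2; lia.
move=> i; rewrite mxE natrB ?(ltnW lt12)// intrB.
rewrite (_ : _ - _ = fr k2 i - fr k1 i); last by rewrite /fr; ring.
have [t1 e1 /andP[a1 b1]] := key k1 i; have [t2 e2 /andP[a2 b2]] := key k2 i.
have {e1 e2} E : t1 = t2 by rewrite -e1 -e2 fk.
subst t2; rewrite -(ler_pM2l n0) divff ?gt_eqF// -[X in X * _]gtr0_norm// -normrM.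
by rewrite ler_norml; apply/andP; split; lra.
Qed.

Lemma dirichlet_approximation1 (n : nat) (x : R) : (0 < n)%N ->
  exists (q : nat) (p : int), (0 < q <= n)%N /\ `|q%:R * x - p%:~R| <= n%:R^-1.
Proof.
move=> /(@dirichlet_approximation 1 n (\row__ x)) [q [p [qn /(_ 0)]]].
by rewrite mxE expn1 in qn * => H; exists q, (p 0 0).
Qed.

End Dirichlet.

Section Separation.
Variable R : realType.

Lemma pos_root_exists (n q : nat) : (0 < n)%N -> (0 < q)%N ->
  exists2 r : R, 0 < r & r ^+ n = q%:R.
Proof.
move=> n0 q0; exists (q%:R `^ n%:R^-1); first by rewrite powR_gt0// ltr0n.
by rewrite -powR_mulrn ?powR_ge0// -powRrM mulVf ?powRr1// pnatr_eq0 -lt0n.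
Qed.

Lemma minimal_power_above (k : nat) (Z : R) : (0 < k)%N -> 1 <= Z ->
  exists2 J : nat, (0 < J)%N & Z <= J%:R ^+ k <= 2 ^+ k * Z.
Proof.
move=> k0 Z1.
have exJ : exists J : nat, Z <= J%:R ^+ k.
  exists (Num.truncn Z).+1; have Z0 : 0 <= Z by rewrite (le_trans _ Z1).
  have /andP[_ /ltW/le_trans] := truncn_itv Z0; apply.
  by rewrite -natrX ler_nat -[leqLHS]expn1 leq_pexp2l.
case: (ex_minnP exJ) => J ZJ minJ.
have J0 : (0 < J)%N.
  rewrite lt0n; apply/eqP => J0; move: ZJ; rewrite J0 expr0n gtn_eqF//.
  by move=> /(le_trans Z1); rewrite ler10.
exists J => //; rewrite ZJ/=.
case: J => [//|[|J]] in ZJ minJ J0 *.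
  by rewrite expr1n -[leLHS]mulr1 ler_pM// exprn_ege1// (ler_nat R 1 2).
have : J.+1%:R ^+ k <= Z.
  by apply/ltW; rewrite ltNge; apply/negP => /minJ; rewrite ltnn.
move=> H; apply: le_trans (ler_wpM2l _ H); last by rewrite exprn_ge0.
rewrite -exprMn lerXn2r ?nnegrE ?mulr_ge0//.
by rewrite -natrM ler_nat; lia.
Qed.

(** Provides the pigeonhole size [J] for [separation], where [v = (q' / q)^(1/d)]. The contradiction
    there needs [J^k] to exceed [A m]. On the other hand the error of [p'/q'] at [xs] gets
    multiplied by up to [J] and must stay of order [1 / J], whence the bound on [J^2]. *)
Lemma pigeonhole_size (k : nat) (A M e v kappa c : R) :
  let A' := 2 ^+ k * A in let m := Num.max 1 (v ^+ k.+1 * e) in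
  (0 < k)%N -> 1 <= A -> 0 <= M -> 0 < e -> 0 < kappa -> kappa <= v ->
  v * e <= c -> c <= 1 -> A' ^+ 2 * M ^+ k * c <= 1 ->
  A' ^+ 2 * (M * e) <= kappa ^+ k -> M * e <= 1 ->
  exists J : nat, [/\ (0 < J)%N, A * m <= J%:R ^+ k, J%:R <= A' * m &
    J%:R ^+ 2 * (M * e) <= v].
Proof.
move=> A' m k0 A1 M0 e0 kap0 kapv vec c1 H1 H2 Me1.
have m1 : 1 <= m by rewrite /m le_max lexx.
have v0 : 0 < v by apply: lt_le_trans kapv.
have A0 : 0 < A by rewrite (lt_le_trans _ A1).
have Am1 : 1 <= A * m by rewrite -[leLHS]mulr1 ler_pM.
have [J J0 /andP[J1 J2]] := minimal_power_above k0 Am1.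
rewrite mulrA -/A' in J2.
exists J; split=> //.
  apply: le_trans J2.
  by rewrite -natrX ler_nat -[leqLHS]expn1 leq_pexp2l.
rewrite -(ler_pXn2r k0) ?nnegrE ?mulr_ge0 ?exprn_ge0 ?(ltW v0) ?(ltW e0)//.
rewrite exprMn exprAC.
have A'0 : 0 <= A' by rewrite mulr_ge0 ?exprn_ge0// ltW.
apply: (@le_trans _ _ ((A' * m) ^+ 2 * (M * e) ^+ k)).
  rewrite ler_wpM2r ?exprn_ge0 ?mulr_ge0 ?(ltW e0)//.
  by rewrite lerXn2r ?nnegrE ?exprn_ge0 ?mulr_ge0// (le_trans ler01).
(* For [m = 1] the smallness of [e] against [kappa <= v] is enough. Otherwise the left side contains
   [(v e)^(k+2) v^k], and [v e <= c] is used. *)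
have [mE|mE] : m = 1 \/ m = v ^+ k.+1 * e.
    by rewrite /m; case: (leP 1 (v ^+ k.+1 * e)); [right|left].
  rewrite mE mulr1; apply: le_trans (_ : kappa ^+ k <= _); last first.
    by rewrite lerXn2r ?nnegrE// ltW.
  apply: le_trans H2; rewrite ler_wpM2l ?exprn_ge0//.
  have Me0 : 0 <= M * e by rewrite mulr_ge0// ltW.
  by rewrite -[leRHS]expr1 ler_wiXn2l.
have -> : (A' * m) ^+ 2 * (M * e) ^+ k =
   A' ^+ 2 * M ^+ k * (v * e) ^+ k.+2 * v ^+ k.
  have Ev : (v ^+ k.+1) ^+ 2 = v ^+ k.+2 * v ^+ k.
    by rewrite -exprD addSn -addnS exprD -expr2.
  have Ee : e ^+ 2 * e ^+ k = e ^+ k.+2 by rewrite -exprD.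
  rewrite mE !exprMn Ev -Ee.
  move: (v ^+ k.+2) (v ^+ k) (e ^+ k) (M ^+ k) => X1 X2 X3 X4.
  ring.
rewrite -[leRHS]mul1r ler_wpM2r ?exprn_ge0 ?(ltW v0)//.
apply: le_trans H1; rewrite ler_wpM2l ?mulr_ge0 ?exprn_ge0 ?(ltW A0)//.
have ve0 : 0 <= v * e by rewrite mulr_ge0// ltW.
apply: (le_trans _ vec).
by rewrite -[leRHS]expr1 ler_wiXn2l// (le_trans vec).
Qed.

End Separation.

Section SeparationLemma.
Variables (R : realType) (k : nat).
Local Notation d := k.+1.
Local Notation N := (@euclidean_norm R d).

(* A combination of (q', p') and (q, p) found by the pigeonhole principle
   would contradict the bad approximability of x. *)
Lemma separation (x xs : 'rV[R]_d) (q q' : nat) (p p' : 'rV[int]_d)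
    (beta beta' s e e1 M kappa c W : R) :
  let A := 3 * (2 * d%:R) ^+ d / e1 ^+ d.+1 in
  let A' := 2 ^+ k * A in let mV := 1 + (c / e) ^+ d * e in
  (0 < k)%N -> 0 < e1 -> e1 <= 1 -> 0 <= M -> 0 < e -> 0 < kappa ->
  c <= 1 -> A' ^+ 2 * M ^+ k * c <= 1 ->
  A' ^+ 2 * (M * e) <= kappa ^+ k -> M * e <= 1 ->
  3 * (A' * mV) * mV / e1 <= W ->
  beta ^+ d = q%:R -> beta' ^+ d = q'%:R -> 0 < beta' ->
  kappa <= beta' / beta -> beta' / beta * e <= c ->
  2 * d%:R <= beta -> beta * N (q%:R *: x - map_mx intr p) <= d%:R ->
  (forall Q P, (0 < Q)%N -> Q%:R <= W * q%:R ->
    e1 ^+ d <= Q%:R * N (Q%:R *: x - map_mx intr P) ^+ d \/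
    2 * d%:R / beta <= N (Q%:R *: x - map_mx intr P)) ->
  q%:R *: xs - map_mx intr p = s *: (q%:R *: x - map_mx intr p) ->
  0 <= s -> s <= 2 * e / e1 ->
  p *+ q' != p' *+ q ->
  M * e / beta' <= N (q'%:R *: xs - map_mx intr p').
Proof.
move=> A A' mV k0 e10 e11 M0 e0 kap0 c1 H1 H2 Me1 HW qE q'E b'0 kapv vec dbeta
  ell Hav xsE s0 s1 npar.
set v := beta' / beta in kapv vec.
have d1 : 1 <= d%:R :> R by rewrite (ler_nat R 1).
have b0 : 0 < beta by rewrite (lt_le_trans _ dbeta)// mulr_gt0// ltr0n.
have v0 : 0 < v by rewrite divr_gt0.
have q'v : q'%:R = v ^+ d * q%:R by rewrite -qE -q'E -exprMn /v divfK// gt_eqF.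
have q0 : 0 < q%:R :> R by rewrite -qE exprn_gt0.
have d20 : 1 <= (2 * d%:R) ^+ d :> R by rewrite exprn_ege1//; lra.
have e1p : 0 < e1 ^+ d.+1 by rewrite exprn_gt0.
have e1p1 : e1 ^+ d.+1 <= 1 by rewrite exprn_ile1// ltW.
have A1 : 1 <= A.
  by rewrite /A ler_pdivlMr// mul1r (le_trans e1p1)//; lra.
have [J [J0 J1 J2 J3]] := pigeonhole_size k0 A1 M0 e0 kap0 kapv vec c1 H1 H2 Me1.
rewrite -/A' in J2; set m := Num.max _ _ in J1 J2.
have m1 : 1 <= m by rewrite le_max lexx.
have mvd : v ^+ d * e <= m by rewrite le_max lexx orbT.
have mmV : m <= mV.
  have cd : v ^+ d * e <= (c / e) ^+ d * e.
    rewrite ler_wpM2r ?(ltW e0)// lerXn2r ?nnegrE ?(ltW v0)//.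
      by rewrite divr_ge0 ?(ltW e0)// (le_trans _ vec)// mulr_ge0// ltW.
    by rewrite ler_pdivlMr.
  have cd0 : 0 <= (c / e) ^+ d * e by apply: le_trans cd; rewrite mulr_ge0 ?exprn_ge0// ltW.
  by rewrite /m ge_max /mV; apply/andP; split; lra.
have J0' : 0 < J%:R :> R by rewrite ltr0n.
have J1' : 1 <= J%:R :> R by rewrite (ler_nat R 1).
rewrite leNgt; apply/negP => close.
(* Since [q' (x - xs) = v^d (1 - s) (q x - p)], the combination below has at [x] the error
   [j (q' xs - p') + tau (q x - p)]; Dirichlet's theorem makes [tau] small. *)
have [j [l [/andP[j0 jJ]]]] := dirichlet_approximation1 (v ^+ d * (1 - s)) J0.
set tau := j%:R * _ - _ => htau.
have j0' : 0 < j%:R :> R by rewrite ltr0n.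
have jJ' : j%:R <= J%:R :> R by rewrite ler_nat.
pose Q : int := j%:Z * q'%:Z - l * q%:Z.
pose P : 'rV[int]_d := \row_i (j%:Z * p' 0 i - l * p 0 i).
have QE : Q%:~R = j%:R * q'%:R - l%:~R * q%:R :> R by rewrite /Q intrB !intrM.
have vecE : Q%:~R *: x - map_mx intr P =
    j%:R *: (q'%:R *: xs - map_mx intr p') + tau *: (q%:R *: x - map_mx intr p).
  apply/rowP => i; move/rowP: xsE => /(_ i); rewrite !mxE QE intrB !intrM => xsi.
  have -> : q'%:R * xs 0 i = v ^+ d * ((p 0 i)%:~R + s * (q%:R * x 0 i - (p 0 i)%:~R)).
    by rewrite -xsi q'v; ring.
  by rewrite /tau q'v -!pmulrn; ring.
set n := N (Q%:~R *: x - map_mx intr P).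
have nlt : n < 2 * d%:R / (beta * J%:R).
  rewrite /n vecE; apply: le_lt_trans (enormD _ _) _.
  rewrite !enormZ (gtr0_norm j0').
  have T1 : j%:R * N (q'%:R *: xs - map_mx intr p') < d%:R / (beta * J%:R).
    apply: lt_le_trans (_ : J%:R * (M * e / beta') <= _).
      apply: lt_le_trans (_ : j%:R * (M * e / beta') <= _).
        by rewrite ltr_pM2l.
      by rewrite ler_wpM2r// divr_ge0 ?mulr_ge0// ltW.
    rewrite ler_pdivlMr ?mulr_gt0// [leLHS](_ : _ = J%:R ^+ 2 * (M * e) / v); last first.
      by rewrite /v invf_div; ring.
    by rewrite ler_pdivrMr// (le_trans J3)// ler_peMl// ltW.
  have T2 : `|tau| * N (q%:R *: x - map_mx intr p) <= d%:R / (beta * J%:R).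
    apply: le_trans (_ : J%:R^-1 * (d%:R / beta) <= _).
      by rewrite ler_pM ?enorm_ge0// ler_pdivlMr// mulrC.
    by rewrite invfM [leRHS](_ : _ = J%:R^-1 * (d%:R / beta)); last by ring.
  rewrite [ltRHS](_ : _ = d%:R / (beta * J%:R) + d%:R / (beta * J%:R)); last by ring.
  exact: ltr_leD.
have nlt2 : n < 2 * d%:R / beta.
  apply: lt_le_trans nlt _.
  rewrite ler_pM2l ?mulr_gt0// ?(lt_le_trans _ d1)// lef_pV2 ?posrE ?mulr_gt0//.
  by rewrite ler_peMr// ltW.
(* If [Q = 0], then [P] is nonzero because the two pairs are not proportional, so its norm is at
   least 1, whereas [2 d / beta <= 1]. *)
have [Q0|Qn0] := eqVneq Q 0.
  have Pn0 : P != 0.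
    apply: contra npar => /eqP P0; apply/eqP/rowP => i.
    move/rowP: P0 => /(_ i); rewrite !mxE => /eqP; rewrite subr_eq0 => /eqP E1.
    move/eqP: Q0; rewrite subr_eq0 => /eqP E2.
    have j0n : (j%:Z : int) != 0 by rewrite eqz_nat -lt0n.
    rewrite !mulmxnE -[LHS]mulr_natr -[RHS]mulr_natr; apply: (mulfI j0n).
    rewrite !natz [LHS](_ : _ = p 0 i * (j%:Z * q'%:Z)); last by ring.
    rewrite E2 [RHS](_ : _ = (j%:Z * p' 0 i) * q%:Z); last by ring.
    by rewrite E1; ring.
  have := enorm_int_ge1 R Pn0; rewrite -enormN.
  rewrite (_ : - _ = Q%:~R *: x - map_mx intr P); last by rewrite Q0 scale0r add0r.
  rewrite -/n => n1; have := le_lt_trans n1 nlt2.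
  by rewrite ltr_pdivlMr// mul1r ltNge dbeta.
have Qab : (`|Q|%N%:R : R) = `|Q%:~R| by rewrite -intr_norm -abszE.
have Qpos : (0 < `|Q|)%N by rewrite absz_gt0.
have nE : N (`|Q|%N%:R *: x - map_mx intr (sgz Q *: P)) = n.
  rewrite Qab normrEsg -intr_sg.
  rewrite (_ : map_mx intr (sgz Q *: P) = (sgz Q)%:~R *: map_mx intr P); last first.
    by apply/rowP => i; rewrite !mxE intrM.
  rewrite -scalerA -scalerBr enormZ -intr_norm normr_sgz Qn0 mul1r //.
(* Here [Q = q (tau + j v^d s)]. As [s] is at most [2 e / e1], the second term is of order
   [J v^d e], which is the reason for [v^d e] in [m]. *)
have QW : `|Q|%N%:R <= q%:R * (3 * J%:R * m / e1).
  have -> : (`|Q|%N%:R : R) = q%:R * `|tau + j%:R * v ^+ d * s|.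
    rewrite Qab -[q%:R in RHS]gtr0_norm// -normrM QE /tau q'v; congr `|_|.
    by ring.
  rewrite ler_pM2l//; apply: le_trans (ler_normD _ _) _.
  have T1 : `|tau| <= J%:R * m / e1.
    apply: le_trans htau _; apply: (@le_trans _ _ 1); first by rewrite invf_le1.
    rewrite ler_pdivlMr// mul1r (le_trans e11)//.
    by rewrite -[leLHS]mulr1 ler_pM.
  have T2 : `|j%:R * v ^+ d * s| <= 2 * (J%:R * m / e1).
    rewrite ger0_norm ?mulr_ge0 ?exprn_ge0 ?(ltW v0)//.
    apply: le_trans (_ : J%:R * v ^+ d * (2 * e / e1) <= _).
      by rewrite !ler_pM ?mulr_ge0 ?exprn_ge0 ?(ltW v0)//.
    rewrite [leLHS](_ : _ = 2 * (J%:R * (v ^+ d * e) / e1)); last by ring.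
    by rewrite ler_pM2l// ler_wpM2r ?invr_ge0 ?(ltW e10)// ler_wpM2l.
  by rewrite [leRHS](_ : _ = J%:R * m / e1 + 2 * (J%:R * m / e1)) ?lerD//; ring.
have QWq : `|Q|%N%:R <= W * q%:R.
  apply: le_trans QW _; rewrite mulrC ler_wpM2r//.
  have A'0 : 0 <= A' by rewrite mulr_ge0 ?exprn_ge0 ?(le_trans ler01 A1).
  have m0 : 0 <= m by rewrite (le_trans ler01 m1).
  apply: le_trans HW; rewrite ler_wpM2r ?invr_ge0 ?(ltW e10)//.
  rewrite ler_pM ?mulr_ge0 ?ler_wpM2l//.
  by rewrite (le_trans J2)// ler_wpM2l.
case: (Hav _ (sgz Q *: P) Qpos QWq); rewrite nE; last by rewrite leNgt nlt2.
have n0 : 0 <= n by exact: enorm_ge0.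
apply/negP; rewrite -ltNge.
apply: le_lt_trans (ler_wpM2r (exprn_ge0 _ n0) QW) _.
apply: (@lt_le_trans _ _ (q%:R * (3 * J%:R * m / e1) * (2 * d%:R / (beta * J%:R)) ^+ d)).
  rewrite ltr_pM2l; last by rewrite !mulr_gt0 ?invr_gt0// (lt_le_trans ltr01 m1).
  by rewrite ltrXn2r// nnegrE mulr_ge0// invr_ge0 mulr_ge0// ltW.
(* One factor [J] from the denominator against [J^-d] from the error leaves [J^-k]; [A] collects the
   remaining constants. *)
have -> : q%:R * (3 * J%:R * m / e1) * (2 * d%:R / (beta * J%:R)) ^+ d =
    (A * m) * (e1 ^+ d / J%:R ^+ k).
  rewrite -qE expr_div_n [(beta * J%:R) ^+ d]exprMn /A [e1 ^+ d.+1]exprS.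
  rewrite [J%:R ^+ d]exprS.
  have X1 : beta ^+ d != 0 by rewrite gt_eqF// exprn_gt0.
  have X2 : e1 ^+ d != 0 by rewrite gt_eqF// exprn_gt0.
  have X3 : J%:R ^+ k != 0 :> R by rewrite gt_eqF// exprn_gt0.
  have X4 : J%:R != 0 :> R by rewrite gt_eqF.
  have X5 : e1 != 0 by rewrite gt_eqF.
  move: (beta ^+ d) (e1 ^+ d) (J%:R ^+ k) ((2 * d%:R) ^+ d) X1 X2 X3 => B1 B2 B3 B4 *.
  by field; rewrite ?X4 ?X5//; repeat (apply/andP; split).
apply: le_trans (ler_wpM2r _ J1) _.
  by rewrite divr_ge0// exprn_ge0// ltW.
by rewrite mulrCA divff ?mulr1// gt_eqF// exprn_gt0.
Qed.

End SeparationLemma.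

(** * Cubes avoiding rationals of bounded denominator *)

Section GoodCubes.
Variables (R : realType) (d : nat).
Local Notation N := (@euclidean_norm R d).
Local Notation C := (@simplex_const R d).

(** A cube of side [h] answers only for the denominators that the simplex lemma settles when the
    cube is chosen as a subcube; larger ones are left to later subdivisions. For side 1 the
    condition is vacuous. *)
Definition good (b : nat) (e h : R) (a : 'rV[R]_d) :=
  forall x, cube a h x -> forall q, (0 < q)%N ->
    q%:R ^+ d.+1 * (C b * h) ^+ d < 1 -> avoid e q x.

(** One factor [b] is lost in passing to a subcube, the other allows [fresh_chain] to include
    denominators that already matter for a cube of side [h b]. *)
Definition bad_const (b : nat) : R := (b%:R ^+ 2 * C b)^-1.

Lemma simplex_const_ge1 b : (0 < b)%N -> 1 <= C b.
Proof. by move=> b0; rewrite /simplex_const -!natrM (ler_nat R 1) !muln_gt0 b0 fact_gt0. Qed.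

Lemma bad_const_gt0 b : (0 < b)%N -> 0 < bad_const b.
Proof.
move=> b0; rewrite invr_gt0 mulr_gt0 ?exprn_gt0 ?ltr0n//.
exact: lt_le_trans (simplex_const_ge1 b0).
Qed.

Lemma bad_const_side b h : (0 < b)%N -> h / b%:R = bad_const b * (C b * (h * b%:R)).
Proof.
move=> b0; have := lt_le_trans ltr01 (simplex_const_ge1 b0).
have : 0 < b%:R :> R by rewrite ltr0n.
rewrite /bad_const; move: (C b) => c b0' c0; field.
by rewrite !gt_eqF.
Qed.

Lemma avoid_le (e e' : R) q x : 0 <= e' -> e' <= e -> avoid e q x -> @avoid R d e' q x.
Proof.
move=> e0 ee' H p; apply: le_trans (H p).
by rewrite lerXn2r// nnegrE// (le_trans e0).
Qed.

Lemma avoid_root (e beta : R) q x : (0 < d)%N -> 0 <= e -> 0 < beta ->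
  beta ^+ d = q%:R ->
  @avoid R d e q x <-> forall p, e / beta <= N (q%:R *: x - map_mx intr p).
Proof.
move=> d0 e0 b0 bq; have E (n : R) : 0 <= n ->
    (e ^+ d <= q%:R * n ^+ d) = (e / beta <= n).
  move=> n0; rewrite -bq -exprMn ler_pXn2r ?nnegrE ?mulr_ge0 ?(ltW b0)//.
  by rewrite ler_pdivrMr// mulrC.
split=> H p; first by rewrite -E ?enorm_ge0.
by rewrite E ?enorm_ge0.
Qed.

Lemma low_root (beta c : R) q : (0 < d)%N -> 0 <= c -> 0 < beta ->
  beta ^+ d = q%:R -> (q%:R ^+ d.+1 * c ^+ d < 1) = (beta ^+ d.+1 * c < 1).
Proof.
move=> d0 c0 b0 <-; rewrite exprAC -exprMn.
by rewrite expr_lt1// mulr_ge0// exprn_ge0// ltW.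
Qed.

Lemma cube_corner (a : 'rV[R]_d) h : 0 <= h -> cube a h a.
Proof. by move=> h0 i; rewrite lexx lerDl. Qed.

Lemma cube_dist (a y : 'rV[R]_d) h : 0 <= h -> cube a h y -> N (y - a) <= d%:R * h.
Proof.
move=> h0 yc; apply: enorm_le => // i.
by rewrite !mxE ler_norml; have /andP[? ?] := yc i; apply/andP; split; lra.
Qed.

Lemma scale_shift (r : R) (x y w : 'rV[R]_d) :
  r *: y - w = (r *: x - w) + r *: (y - x).
Proof. by apply/rowP => i; rewrite !mxE; ring. Qed.

Lemma step_nonempty b (S : {set {ffun 'I_d -> 'I_b}}) :
  ((4 * d).+1 < b)%N -> (#|~: S| * b <= (4 * d).+1 * b ^ d)%N ->
  exists c, c \in S.
Proof.
move=> bd Sb; apply/set0Pn; apply/eqP => S0.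
have b0 : (0 < b)%N by apply: leq_ltn_trans bd.
move: Sb; rewrite S0 finset.setC0 cardsT card_ffun !card_ord mulnC.
rewrite leq_mul2r => /orP[|]; first by rewrite expn_eq0 gtn_eqF.
by rewrite leqNgt bd.
Qed.

(** Nothing is assumed about the initial cube, so the constant is [bad_const b] for all denominators
    in the range, even inside a cube that is good only for a much smaller [e]. *)
Lemma fresh_chain b h (a : 'rV[R]_d) n : (0 < d)%N -> ((4 * d).+1 < b)%N -> 0 < h ->
  exists2 a', cube a' (h / b%:R ^+ n.+1) `<=` cube a h &
    forall x, cube a' (h / b%:R ^+ n.+1) x -> forall q,
      1 <= (C b * (h * b%:R)) ^+ d * q%:R ^+ d.+1 ->
      q%:R ^+ d.+1 * (C b * (h / b%:R ^+ n.+1)) ^+ d < 1 ->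
      avoid (bad_const b) q x.
Proof.
move=> d0 bd h0; have b2 : (2 <= b)%N by apply: leq_ltn_trans bd.
have b0 : (0 < b)%N by apply: leq_trans b2.
have b0' : 0 < b%:R :> R by rewrite ltr0n.
have e0 := bad_const_gt0 b0; have C0 := lt_le_trans ltr01 (simplex_const_ge1 b0).
have key g (q : nat) : 0 < g -> 1 <= (C b * (g * b%:R)) ^+ d * q%:R ^+ d.+1 ->
    bad_const b ^+ d <= (g / b%:R) ^+ d * q%:R ^+ d.+1.
  move=> g0 H; rewrite bad_const_side// exprMn -mulrA.
  by rewrite ler_peMr// exprn_ge0// ltW.
elim: n => [|n [a' a'a Ha']].
  have [S [Sb HS]] := @most_children_avoid R d b a h (bad_const b) d0 b2 h0.
  have [c cS] := step_nonempty bd Sb; exists (child a h c); rewrite expr1.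
    by apply: cube_child => //; exact: ltW.
  by move=> x xc q q1 q2; apply: HS xc _ _ q2; rewrite // key.
set g := h / b%:R ^+ n.+1 in a'a Ha' *.
have g0 : 0 < g by rewrite divr_gt0// exprn_gt0.
have -> : h / b%:R ^+ n.+2 = g / b%:R by rewrite /g exprSr invfM mulrA.
clearbody g.
have [S [Sb HS]] := @most_children_avoid R d b a' g (bad_const b) d0 b2 g0.
have [c cS] := step_nonempty bd Sb; exists (child a' g c).
  by apply: subset_trans a'a; apply: cube_child => //; exact: ltW.
move=> x xc q q1 q2.
have [low|high] := ltP (q%:R ^+ d.+1 * (C b * g) ^+ d) 1.
  by apply: Ha' => //; apply: cube_child xc => //; exact: ltW.
apply: HS xc _ _ q2; rewrite // key//; apply: le_trans high _.
rewrite mulrC ler_wpM2r ?exprn_ge0// lerXn2r ?nnegrE ?mulr_ge0 ?(ltW C0) ?(ltW g0)//.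
by rewrite ler_wpM2l ?(ltW C0)// ler_peMr ?(ltW g0)// (ler_nat R 1).
Qed.

(** Denominators low for the parent are inherited; those that become low only for the subcubes are
    settled by the simplex lemma with the larger constant [bad_const b]. *)
Lemma good_step b e h (a : 'rV[R]_d) : (0 < d)%N -> (2 <= b)%N -> 0 < h ->
  0 <= e -> e <= bad_const b -> good b e h a ->
  exists S : {set {ffun 'I_d -> 'I_b}},
    (#|~: S| * b <= (4 * d).+1 * b ^ d)%N /\
    forall c, c \in S -> good b e (h / b%:R) (child a h c).
Proof.
move=> d0 b2 h0 e0 ee1 ga.
have b0 : (0 < b)%N by apply: leq_trans b2.
have b0' : 0 < b%:R :> R by rewrite ltr0n.
have C0 := lt_le_trans ltr01 (simplex_const_ge1 b0).
have [S [Sb HS]] := @most_children_avoid R d b a h (bad_const b) d0 b2 h0.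
exists S; split=> // c cS x xc q q0 q2.
have [low|high] := ltP (q%:R ^+ d.+1 * (C b * h) ^+ d) 1.
  by apply: ga => //; apply: cube_child xc => //; exact: ltW.
apply: avoid_le ee1 _ => //; apply: HS xc _ _ q2 => //.
rewrite bad_const_side// exprMn -mulrA ler_peMr ?exprn_ge0 ?(ltW (bad_const_gt0 b0))//.
apply: le_trans high _.
rewrite mulrC ler_wpM2r ?exprn_ge0// lerXn2r ?nnegrE ?mulr_ge0 ?(ltW C0) ?(ltW h0)//.
by rewrite ler_wpM2l ?(ltW C0)// ler_peMr ?(ltW h0)// (ler_nat R 1).
Qed.

Lemma good_chain b e h (a : 'rV[R]_d) n : (0 < d)%N -> ((4 * d).+1 < b)%N -> 0 < h ->
  0 <= e -> e <= bad_const b -> good b e h a ->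
  exists2 a', cube a' (h / b%:R ^+ n) `<=` cube a h & good b e (h / b%:R ^+ n) a'.
Proof.
move=> d0 bd h0 e0 ee1 ga; have b2 : (2 <= b)%N by apply: leq_ltn_trans bd.
have b0 : (0 < b)%N by apply: leq_trans b2.
have b0' : 0 < b%:R :> R by rewrite ltr0n.
elim: n => [|n [a' a'a ga']]; first by exists a; rewrite expr0 divr1.
set g := h / b%:R ^+ n in a'a ga' *.
have g0 : 0 < g by rewrite divr_gt0// exprn_gt0.
have -> : h / b%:R ^+ n.+1 = g / b%:R by rewrite /g exprSr invfM mulrA.
clearbody g.
have [S [Sb HS]] := good_step d0 b2 g0 e0 ee1 ga'.
have [c cS] := step_nonempty bd Sb; exists (child a' g c); last exact: HS.
by apply: subset_trans a'a; apply: cube_child => //; exact: ltW.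
Qed.

Lemma geometric_level (b : nat) (z : R) : (2 <= b)%N -> 0 < z -> z <= 1 ->
  exists n, z <= (b%:R ^+ n)^-1 <= b%:R * z.
Proof.
move=> b2 z0 z1; have b0 : 0 < b%:R :> R by rewrite ltr0n; lia.
have exn : exists n, z^-1 < b%:R ^+ n.
  exists (Num.truncn z^-1).+1; have z0' : 0 <= z^-1 by rewrite invr_ge0 ltW.
  have /andP[_ /lt_le_trans] := truncn_itv z0'; apply.
  by rewrite -natrX ler_nat ltnW// ltn_expl.
case: (ex_minnP exn) => -[|n] zn minn.
  by move: zn; rewrite expr0 invf_lt1// ltNge z1.
have zn' : b%:R ^+ n <= z^-1 by rewrite leNgt; apply/negP => /minn; rewrite ltnn.
exists n; apply/andP; split.
  by rewrite -[leLHS]invrK lef_pV2 ?posrE ?exprn_gt0 ?invr_gt0.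
rewrite -[leRHS]invrK lef_pV2 ?posrE ?exprn_gt0 ?invr_gt0 ?mulr_gt0//.
by rewrite invfM mulrC ler_pdivrMr// -exprSr ltW.
Qed.

(** The least denominator satisfying Dirichlet's inequality gives a reduced fraction: a proportional
    pair with smaller denominator would satisfy it as well. Proportional pairs are the ones that
    [separation] excludes. *)
Lemma good_approximation (x : 'rV[R]_d) (Z : R) : 1 <= Z ->
  exists (n q : nat) (p : 'rV[int]_d), [/\ (0 < n)%N,
    Z <= n%:R ^+ d.+1 <= 2 ^+ d.+1 * Z, (0 < q <= n ^ d)%N,
    N (q%:R *: x - map_mx intr p) <= d%:R / n%:R &
    forall q' p', (0 < q')%N -> p *+ q' = p' *+ q -> (q <= q')%N].
Proof.
move=> Z1; have [n n0 nZ] := minimal_power_above (ltn0Sn d) Z1.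
have n0' : 0 < n%:R :> R by rewrite ltr0n.
pose ok q := `[< (0 < q <= n ^ d)%N /\ exists p : 'rV[int]_d,
    forall i, `|q%:R * x 0 i - (p 0 i)%:~R| <= n%:R^-1 >].
have exq : exists q, ok q.
  have [q [p [qn H]]] := dirichlet_approximation x n0.
  by exists q; apply/asboolP; split=> //; exists p.
case: (ex_minnP exq) => q /asboolP[qn [p H]] minq.
exists n, q, p; split=> //.
  by apply: enorm_le => [|i]; rewrite ?invr_ge0 ?(ltW n0')// !mxE.
move=> q' p' q'0 pp'; rewrite leqNgt; apply/negP => q'q.
have /andP[q0 qnd] := qn; have q0' : 0 < q%:R :> R by rewrite ltr0n.
suff : ok q' by move=> /minq; rewrite leqNgt q'q.
apply/asboolP; split; first by rewrite q'0 (leq_trans (ltnW q'q)).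
exists p' => i; rewrite -(ler_pM2l q0') -[X in X * `|_|]gtr0_norm// -normrM.
have -> : q%:R * (q'%:R * x 0 i - (p' 0 i)%:~R) = q'%:R * (q%:R * x 0 i - (p 0 i)%:~R).
  have : (p' 0 i)%:~R * q%:R = (p 0 i)%:~R * q'%:R :> R.
    move/rowP: pp' => /(_ i); rewrite !mulmxnE => /(congr1 (fun t : int => t%:~R : R)).
    by rewrite !rmorphMn/= -[LHS]mulr_natr -[RHS]mulr_natr => ->.
  by move=> E; rewrite !mulrBr [X in _ - X]mulrC E; ring.
rewrite normrM ger0_norm// ler_pM// ?H//.
by rewrite ler_nat ltnW.
Qed.

End GoodCubes.

(** * Hitting the shell around a rational *)

Section SpecialCore.
Variables (R : realType) (k : nat).
Local Notation d := k.+1.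
Local Notation N := (@euclidean_norm R d).
Local Notation C := (@simplex_const R d).

(** The denominators [q'] up to [(c/e)^d q] fall into four classes. Those low for [h] are covered by
    the goodness of the given cube; for those much smaller than [q] the point [y] inherits the bound
    of [x]; pairs proportional to [(q, p)] have a denominator at least [q] and do no better than
    [p/q]; the others are handled by [separation]. *)
Lemma special_core (b : nat) (e c W Y h beta : R) (a x : 'rV[R]_d)
    (q : nat) (p : 'rV[int]_d) :
  let e1 := bad_const R d b in
  let M := 1 + d%:R * b%:R ^+ 2 in let kappa := e1 / (4 * d%:R) in
  let A' := 2 ^+ k * (3 * (2 * d%:R) ^+ d / e1 ^+ d.+1) in
  let mV := 1 + (c / e) ^+ d * e in
  (0 < k)%N -> ((4 * d).+1 < b)%N -> 0 < e -> 0 < c -> c <= 1 -> e <= c ->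
  2 * e <= e1 -> 2 * d%:R * b%:R ^+ 2 * e <= c ^+ d.+1 ->
  A' ^+ 2 * M ^+ k * c <= 1 -> A' ^+ 2 * (M * e) <= kappa ^+ k -> M * e <= 1 ->
  3 * (A' * mV) * mV / e1 <= W -> 1 <= W ->
  2 * b%:R ^+ 3 * d%:R / e <= Y ->
  0 < h -> h <= 1 -> good b e h a ->
  (forall i, a 0 i + h / b%:R <= x 0 i <= a 0 i + h - h / b%:R) ->
  (forall Q, (0 < Q)%N -> Q%:R <= W * q%:R ->
    (Q%:R ^+ d.+1 * (C b * h) ^+ d < 1 /\ avoid e Q x) \/ avoid e1 Q x) ->
  0 < beta -> beta ^+ d = q%:R ->
  e1 <= beta * N (q%:R *: x - map_mx intr p) ->
  beta * N (q%:R *: x - map_mx intr p) <= d%:R ->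
  Y ^+ d.+1 <= h * beta ^+ d.+1 ->
  (forall q' p', (0 < q')%N -> p *+ q' = p' *+ q -> (q <= q')%N) ->
  exists (m : nat) (xs : 'rV[R]_d), let T := h / b%:R ^+ m in
    [/\ cube xs T `<=` cube a h,
        b%:R * e / (c / e * beta) ^+ d.+1 <= T,
        forall y, cube xs T y ->
          beta * N (q%:R *: y - map_mx intr p) <= e * (1 + e ^+ d) &
        forall y, cube xs T y -> forall q', (0 < q')%N ->
          q'%:R <= (c / e * beta) ^+ d -> avoid e q' y].
Proof.
move=> e1 M kappa A' mV k0 bd e0 c0 c1 ec He1 He2 H1 H2 H3 HW W1 HY h0 h1 ga xin
  HF b0 bq lo hi Yb minq.
have bn : (0 < b)%N by apply: leq_ltn_trans bd.
have B0 : 0 < b%:R :> R by rewrite ltr0n.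
have B1 : 1 <= b%:R :> R by rewrite (ler_nat R 1).
have b2 : (2 <= b)%N by apply: leq_ltn_trans bd.
set D : R := d%:R in He2 M kappa HY hi H1 H2 H3 *.
have D1 : 1 <= D by rewrite /D (ler_nat R 1).
have D0 : 0 < D by rewrite (lt_le_trans ltr01).
have C1 : 1 <= C b by exact: simplex_const_ge1.
have e10 : 0 < e1 by exact: bad_const_gt0.
have e1b : e1 * b%:R ^+ 2 <= 1.
  by rewrite /e1 /bad_const invfM mulrAC mulVf ?mul1r ?gt_eqF ?exprn_gt0// invf_le1// (lt_le_trans ltr01).
have B21 : 1 <= b%:R ^+ 2 :> R by rewrite exprn_ege1.
have e11 : e1 <= 1 by apply: le_trans e1b; rewrite ler_peMr// ltW.
have e_1 : e <= 1 by rewrite (le_trans ec).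
have b2e : b%:R ^+ 2 * e <= 1.
  apply: le_trans e1b; rewrite mulrC ler_wpM2r ?exprn_ge0//; move: e0 He1; clear; lra.
have Ybig : 2 * b%:R ^+ 3 * D <= Y.
  apply: le_trans HY; rewrite ler_peMr ?mulr_ge0 ?exprn_ge0 ?(ltW D0)//.
  by rewrite invf_ge1.
have B31 : 1 <= b%:R ^+ 3 :> R by rewrite exprn_ege1.
have Y1 : 1 <= Y.
  apply: le_trans Ybig; rewrite -[leLHS]mulr1 ler_pM//.
  by rewrite -[leLHS]mulr1 ler_pM// (ler_nat R 1 2).
have YY : Y <= Y ^+ d.+1 by rewrite -[leLHS]expr1 ler_weXn2l.
have q0 : 0 < q%:R :> R by rewrite -bq exprn_gt0.
set v := N _ in lo hi *.
have v0 : 0 < v by rewrite -(pmulr_rgt0 _ b0) (lt_le_trans e10).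
set V := c / e; have V1 : 1 <= V by rewrite /V ler_pdivlMr// mul1r.
have V0 : 0 < V by rewrite (lt_le_trans ltr01).
have VD1 : 1 <= V ^+ d.+1 by rewrite exprn_ege1.
set bD := beta ^+ d.+1 in Yb *.
have bD0 : 0 < bD by rewrite exprn_gt0.
have bDE : bD = beta * q%:R by rewrite /bD exprS bq.
have VbE : (V * beta) ^+ d.+1 = V ^+ d.+1 * bD by rewrite exprMn.
have VbD0 : 0 < V ^+ d.+1 * bD by rewrite mulr_gt0// exprn_gt0.
have hbD t : 0 <= t -> t / bD <= t * h / Y.
  move=> t0; rewrite ler_pdivlMr ?(lt_le_trans ltr01)// mulrAC ler_pdivrMr//.
  by rewrite -mulrA ler_wpM2l// (le_trans YY).
have z0 : 0 < b%:R * e / (V * beta) ^+ d.+1 / h.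
  by rewrite VbE; apply: divr_gt0 => //; apply: divr_gt0 => //; exact: mulr_gt0.
have z1 : b%:R * e / (V * beta) ^+ d.+1 / h <= 1.
  rewrite ler_pdivrMr// mul1r ler_pdivrMr ?VbE// mulrCA.
  apply: le_trans (_ : 1 <= _); last first.
    by rewrite -[leLHS]mulr1 ler_pM// (le_trans _ Yb)// (le_trans Y1 YY).
  by apply: le_trans b2e; rewrite ler_wpM2r ?(ltW e0)// -[leLHS]expr1 ler_weXn2l.
(* The side [T] is fixed up to a factor [b]: the lower bound lets the simplex lemma take over
   afterwards, the upper bound keeps the cube in the shell. *)
have [m /andP[m1 m2]] := geometric_level b2 z0 z1.
set T := h / b%:R ^+ m.
have T0 : 0 < T by rewrite divr_gt0// exprn_gt0.
have Tlo : b%:R * e / (V * beta) ^+ d.+1 <= T.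
  by rewrite /T -ler_pdivrMl// mulrC.
have Thi : T <= b%:R ^+ 2 * e / (V ^+ d.+1 * bD).
  rewrite /T -ler_pdivlMl// (le_trans m2)// VbE le_eqVlt; apply/orP; left.
  by apply/eqP; rewrite expr2; ring.
have Thi' : T <= b%:R ^+ 2 * e / bD.
  apply: le_trans Thi _; rewrite ler_pM2l ?mulr_gt0 ?exprn_gt0//.
  by rewrite lef_pV2 ?posrE// ler_peMl// ltW.
have Thi2 : D * T <= D / bD.
  rewrite ler_pM2l// (le_trans Thi')//.
  by rewrite -[leRHS]mul1r ler_pM2r ?invr_gt0.
(* [Th] and [DhD] share the margin [h / b] around [x] between the side of the new cube and the
   distance from [x] to [xs]. *)
have Th : T <= h / b%:R / 2.
  apply: le_trans Thi' _; apply: le_trans (hbD _ _) _.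
    by rewrite mulr_ge0 ?exprn_ge0// ltW.
  rewrite ler_pdivrMr ?(lt_le_trans ltr01)//.
  apply: (@le_trans _ _ (b%:R ^+ 2 * h)).
    by rewrite -mulrA ler_wpM2l ?exprn_ge0// ler_piMl// ltW.
  apply: (@le_trans _ _ (h / b%:R / 2 * (2 * b%:R ^+ 3))).
    rewrite le_eqVlt; apply/orP; left; apply/eqP; rewrite !exprS expr0.
    by field; rewrite gt_eqF.
  rewrite ler_pM2l ?divr_gt0//; apply: le_trans Ybig.
  by rewrite ler_peMr// mulr_ge0// exprn_ge0.
have DhD : D / bD <= h / b%:R / 2.
  apply: le_trans (hbD _ (ltW D0)) _; rewrite ler_pdivrMr ?(lt_le_trans ltr01)//.
  apply: (@le_trans _ _ (h / b%:R / 2 * (2 * b%:R * D))).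
    rewrite le_eqVlt; apply/orP; left; apply/eqP.
    by field; rewrite gt_eqF.
  rewrite ler_pM2l ?divr_gt0//; apply: le_trans Ybig.
  rewrite ler_pM2r// ler_pM2l// -[leLHS]expr1 ler_weXn2l//.
(* The point [xs] is placed in the middle of the shell, at [beta |q xs - p| = e (1 + sigma)], with
   room [e sigma] on either side. *)
pose sigma := e ^+ d / 2.
have ed1 : e ^+ d <= 1 by rewrite exprn_ile1// ltW.
have ed0 : 0 < e ^+ d by rewrite exprn_gt0.
pose s := e * (1 + sigma) / (beta * v).
have bv0 : 0 < beta * v by rewrite mulr_gt0.
have sg0 : 0 < 1 + sigma by rewrite /sigma; move: ed0; clear; lra.
have sg2 : 1 + sigma <= 2 by rewrite /sigma; move: ed1; clear; lra.
have s0 : 0 < s by rewrite divr_gt0// mulr_gt0.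
have s1 : s <= 2 * e / e1.
  rewrite /s ler_pM ?invr_ge0 ?mulr_ge0 ?(ltW e0) ?(ltW b0) ?(ltW v0) ?(ltW sg0)//.
  - by rewrite mulrC ler_pM2r.
  - by rewrite lef_pV2.
have s_1 : s <= 1 by apply: le_trans s1 _; rewrite ler_pdivrMr// mul1r.
pose xs : 'rV[R]_d := q%:R^-1 *: (map_mx intr p + s *: (q%:R *: x - map_mx intr p)).
have xsE : q%:R *: xs - map_mx intr p = s *: (q%:R *: x - map_mx intr p).
  by rewrite /xs scalerA divff ?gt_eqF// scale1r addrAC subrr add0r.
have vD : v / q%:R <= D / bD.
  rewrite bDE ler_pdivrMr// [leRHS](_ : _ = D / beta); last by field; rewrite !gt_eqF.
  by rewrite ler_pdivlMr// mulrC.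
have xsx : N (xs - x) <= D / bD.
  have -> : xs - x = ((s - 1) / q%:R) *: (q%:R *: x - map_mx intr p).
    apply/rowP => i; rewrite !mxE; field.
    by rewrite gt_eqF.
  rewrite enormZ -/v normrM normfV [`|q%:R|]gtr0_norm// mulrAC.
  apply: le_trans vD; rewrite ler_pM2r ?invr_gt0// ler_piMl ?(ltW v0)//.
  by rewrite ler_norml; apply/andP; split; move: s0 s_1; clear; lra.
have xsT y : cube xs T y -> N (y - xs) <= D * T.
  by apply: cube_dist; exact: ltW.
clearbody xs.
have suba : cube xs T `<=` cube a h.
  move=> y yc i; have := yc i; have := xin i.
  have := le_trans (enorm_coord (xs - x) i) xsx; rewrite !mxE ler_norml.
  move: Th DhD; clear => h1 h2 /andP[h3 h4] /andP[h5 h6] /andP[h7 h8].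
  by apply/andP; split; lra.
(* The estimate behind the width of the shell: the left side bounds the variation of
   [beta |q y - p|] over the cube. It is of order [e^(d+2) / c^(d+1)], and [He2] brings it below
   [e^(d+1) / 2]. *)
have bT : bD * (D * T) <= e * sigma.
  apply: (@le_trans _ _ (D * (b%:R ^+ 2 * e) / V ^+ d.+1)).
    apply: le_trans (ler_wpM2l (ltW bD0) (ler_wpM2l (ltW D0) Thi)) _.
    rewrite le_eqVlt; apply/orP; left; apply/eqP.
    move: (V ^+ d.+1) (lt_le_trans ltr01 VD1) => VV VV0.
    by field; rewrite !gt_eqF.
  have -> : D * (b%:R ^+ 2 * e) / V ^+ d.+1 = D * (b%:R ^+ 2 * e) * e ^+ d.+1 / c ^+ d.+1.
    by rewrite /V expr_div_n invf_div !mulrA.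
  rewrite ler_pdivrMr ?exprn_gt0//.
  have := ler_wpM2l (ltW ed0) He2 => H.
  apply: (@le_trans _ _ (e / 2 * (e ^+ d * (2 * D * b%:R ^+ 2 * e)))); last first.
    apply: le_trans (ler_wpM2l _ H) _; first by rewrite divr_ge0// ltW.
    by rewrite /sigma le_eqVlt; apply/orP; left; apply/eqP; ring.
  by rewrite [e ^+ d.+1]exprS le_eqVlt; apply/orP; left; apply/eqP; field.
have yq y := scale_shift q%:R xs y (map_mx intr p).
have Nxs : beta * N (q%:R *: xs - map_mx intr p) = e * (1 + sigma).
  rewrite xsE enormZ -/v gtr0_norm// /s; field.
  by rewrite !gt_eqF.
have Nq y : cube xs T y -> beta * N (q%:R *: (y - xs)) <= e * sigma.
  move=> /xsT H; rewrite enormZ (gtr0_norm q0) mulrA -bDE; apply: le_trans bT.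
  by rewrite ler_pM2l.
exists m, xs; split=> //.
  move=> y yc; rewrite yq; apply: le_trans (ler_wpM2l (ltW b0) (enormD _ _)) _.
  by rewrite mulrDr Nxs; have := Nq y yc; rewrite /sigma; clear; lra.
move=> y yc q' q'0 q'V.
have [beta' b'0 b'E] := pos_root_exists R (ltn0Sn k) q'0.
have Vb0 : 0 < V * beta by rewrite mulr_gt0.
have {}q'V : beta' <= V * beta.
  rewrite leNgt; apply/negP => H; move: q'V; rewrite -b'E leNgt => /negP; apply.
  by rewrite ltr_pXn2r ?nnegrE ?(ltW Vb0) ?(ltW b'0).
have hq'0 : 0 < q'%:R :> R by rewrite ltr0n.
have [low|high] := ltP (q'%:R ^+ d.+1 * (C b * h) ^+ d) 1.
  by apply: ga low => //; exact: suba.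
apply/(avoid_root _ (ltn0Sn k) (ltW e0) b'0 b'E) => p'.
(* With [kappa = e1 / (4 d)], moving from [x] to [y] costs at most half of [e1 / beta']; the
   remaining half is at least [e / beta']. *)
have [kap|kap] := ltP (beta' / beta) kappa.
  have kap1 : kappa <= 1.
    by rewrite /kappa ler_pdivrMr ?mulr_gt0// mul1r; move: e11 D1; clear; lra.
  have b'b : beta' <= beta.
    by rewrite -[leRHS]mul1r -ler_pdivrMr// ltW// (lt_le_trans kap).
  have q'q : q'%:R <= W * q%:R.
    apply: (@le_trans _ _ q%:R); last by rewrite ler_peMl// ltW.
    by rewrite -b'E -bq lerXn2r ?nnegrE ?(ltW b0) ?(ltW b'0).
  case: (HF _ q'0 q'q) => [[low]|]; first by move: high; rewrite leNgt low.
  move=> /(avoid_root _ (ltn0Sn k) (ltW e10) b'0 b'E) /(_ p') Hx.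
  have yx : N (y - x) <= 2 * D / bD.
    rewrite -(subrK xs y) -addrA; apply: le_trans (enormD _ _) _.
    by have := xsT y yc; move: Thi2 xsx; clear; lra.
  have E := scale_shift q'%:R x y (map_mx intr p').
  have S1 : q'%:R * N (y - x) <= e1 / (2 * beta').
    apply: le_trans (ler_wpM2l (ltW hq'0) yx) _.
    have -> : q'%:R * (2 * D / bD) = 2 * D / beta' * (beta' / beta) ^+ d.+1.
      rewrite expr_div_n [beta' ^+ d.+1]exprS b'E -/bD; field.
      by rewrite !gt_eqF.
    apply: (@le_trans _ _ (2 * D / beta' * kappa)).
      rewrite ler_pM2l ?divr_gt0 ?mulr_gt0//; apply: le_trans (ltW kap).
      have vv1 : beta' / beta <= 1 by rewrite ler_pdivrMr// mul1r.
      by rewrite -[leRHS]expr1 ler_wiXn2l// divr_ge0// ltW.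
    rewrite /kappa le_eqVlt; apply/orP; left; apply/eqP; field.
    by rewrite !gt_eqF.
  have S2 : N (q'%:R *: x - map_mx intr p') <=
      N (q'%:R *: y - map_mx intr p') + q'%:R * N (y - x).
    rewrite -(gtr0_norm hq'0) -enormZ -[N (_ *: (y - x))]enormN.
    rewrite (gtr0_norm hq'0).
    by apply: le_trans (enormD _ _); rewrite E addrK.
  have S3 : e / beta' <= e1 / (2 * beta').
    by rewrite invfM mulrA ler_pM2r ?invr_gt0//; move: He1; clear; lra.
  have S4 : e1 / beta' = e1 / (2 * beta') + e1 / (2 * beta').
    by field; rewrite gt_eqF.
  by move: S1 S2 S3 S4 Hx; clear; lra.
have [par|npar] := eqVneq (p *+ q') (p' *+ q).
  have qq' := minq _ _ q'0 par.
  have bb' : beta <= beta'.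
    rewrite leNgt; apply/negP => H; move: qq'; rewrite leqNgt => /negP; apply.
    by rewrite -(ltr_nat R) -bq -b'E ltr_pXn2r ?nnegrE ?(ltW b0) ?(ltW b'0).
  have E : q'%:R *: y - map_mx intr p' =
      (q'%:R / q%:R) *: (q%:R *: y - map_mx intr p).
    apply/rowP => i; rewrite !mxE.
    have : (p' 0 i)%:~R * q%:R = (p 0 i)%:~R * q'%:R :> R.
      move/rowP: par => /(_ i); rewrite !mulmxnE => /(congr1 (fun t : int => t%:~R : R)).
      by rewrite !rmorphMn/= -[LHS]mulr_natr -[RHS]mulr_natr => ->.
    move=> /(canRL (mulfK (lt0r_neq0 q0))) ->; field.
    by rewrite gt_eqF.
  have lower : e / beta <= N (q%:R *: y - map_mx intr p).
    rewrite ler_pdivrMr// mulrC.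
    have : beta * N (q%:R *: xs - map_mx intr p) <=
        beta * N (q%:R *: y - map_mx intr p) + beta * N (q%:R *: (y - xs)).
      rewrite -mulrDr ler_pM2l// -[N (_ *: (y - xs))]enormN.
      by apply: le_trans (enormD _ _); rewrite (yq y) addrK.
    by rewrite Nxs; have := Nq y yc; clear; lra.
  rewrite E enormZ gtr0_norm ?divr_gt0//.
  apply: le_trans (ler_wpM2l _ lower); last by rewrite divr_ge0// ltW.
  rewrite ler_pdivrMr// [leRHS](_ : _ = e * (beta' * q'%:R / (beta * q%:R))); last first.
    by field; rewrite !gt_eqF.
  rewrite ler_peMr ?(ltW e0)// ler_pdivlMr ?mulr_gt0// mul1r ler_pM ?(ltW b0)//.
  by rewrite ler_nat.
(* The summand [d b^2] of [M] pays for the passage from [xs] to [y] in [S5]. *)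
have sep : M * e / beta' <= N (q'%:R *: xs - map_mx intr p').
  apply: (@separation R k x xs q q' p p' beta beta' s e e1 M kappa c W) => //.
  - by rewrite /M addr_ge0// mulr_ge0 ?exprn_ge0// ltW.
  - by rewrite divr_gt0// mulr_gt0.
  - by rewrite -ler_pdivlMr// ler_pdivrMr.
  - rewrite -(@ler_pXn2r _ d.+1) ?nnegrE ?mulr_ge0 ?(ltW D0) ?(ltW b0)//.
    apply: le_trans (_ : Y ^+ d.+1 <= _).
      rewrite lerXn2r ?nnegrE ?mulr_ge0 ?(le_trans ler01 Y1) ?(ltW D0)//.
      by apply: le_trans Ybig; rewrite ler_pM2r// ler_peMr.
    by apply: le_trans Yb _; rewrite ler_piMl// ltW.
  (* For a denominator [Q = r^d] low for [h] only the weak bound [e / r] is known, but [Y] makes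
     [beta] so large that [e / r >= 2 d / beta]. *)
  - move=> Q P Q0 QW; case: (HF _ Q0 QW) => [[low av]|av]; last by left; exact: av.
    right; have [r r0 rE] := pos_root_exists R (ltn0Sn k) Q0.
    move: av => /(avoid_root _ (ltn0Sn k) (ltW e0) r0 rE) /(_ P).
    apply: le_trans; rewrite ler_pdivrMr// mulrAC ler_pdivlMr//.
    move: low; rewrite (low_root (ltn0Sn k) _ r0 rE) ?mulr_ge0 ?(ltW h0) ?(le_trans ler01 C1)//.
    move=> low; rewrite leNgt; apply/negP => H.
    move: low; rewrite ltNge => /negP; apply.
    apply: (@le_trans _ _ (r ^+ d.+1 * h)); last first.
      by rewrite ler_pM2l ?exprn_gt0// ler_peMl// ltW.
    have H' : e * beta / (2 * D) < r by rewrite ltr_pdivrMr ?mulr_gt0// [ltRHS]mulrC.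
    apply: (@le_trans _ _ ((e * beta / (2 * D)) ^+ d.+1 * h)); last first.
      rewrite ler_pM2r// lerXn2r ?nnegrE ?(ltW r0) ?(ltW H')//.
      by rewrite divr_ge0 ?mulr_ge0// ltW.
    rewrite expr_div_n exprMn -/bD [leRHS](_ : _ = (e / (2 * D)) ^+ d.+1 * (h * bD)); last first.
      by rewrite expr_div_n; ring.
    apply: (@le_trans _ _ ((e / (2 * D)) ^+ d.+1 * Y ^+ d.+1)); last first.
      by rewrite ler_wpM2l ?exprn_ge0// divr_ge0 ?mulr_ge0// ltW.
    rewrite -exprMn exprn_ege1// mulrAC ler_pdivlMr ?mulr_gt0// mul1r.
    rewrite -ler_pdivrMl// mulrC; apply: le_trans HY.
    by rewrite ler_pM2r ?invr_gt0// ler_pM2r// ler_peMr.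
  - exact: ltW.
have S5 : q'%:R * N (y - xs) <= D * b%:R ^+ 2 * e / beta'.
  apply: (@le_trans _ _ (q'%:R * (D * T))); first by rewrite ler_wpM2l ?xsT// ltW.
  apply: (@le_trans _ _ (q'%:R * (D * (b%:R ^+ 2 * e / (V ^+ d.+1 * bD))))).
    by rewrite ler_pM2l// ler_pM2l.
  rewrite ler_pdivlMr// -VbE -b'E.
  have -> : beta' ^+ d * (D * (b%:R ^+ 2 * e / (V * beta) ^+ d.+1)) * beta' =
     D * b%:R ^+ 2 * e * (beta' / (V * beta)) ^+ d.+1.
    by rewrite expr_div_n [beta' ^+ d.+1]exprSr; ring.
  rewrite ler_piMr ?mulr_ge0 ?exprn_ge0 ?(ltW D0) ?(ltW e0)//.
  rewrite exprn_ile1 ?divr_ge0 ?(ltW Vb0) ?(ltW b'0)//.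
  by rewrite ler_pdivrMr// mul1r.
have E := scale_shift q'%:R xs y (map_mx intr p').
have S6 : N (q'%:R *: xs - map_mx intr p') <=
    N (q'%:R *: y - map_mx intr p') + q'%:R * N (y - xs).
  rewrite -[q'%:R * _](_ : N (q'%:R *: (y - xs)) = _); last by rewrite enormZ gtr0_norm.
  rewrite -[N (_ *: (y - xs))]enormN.
  by apply: le_trans (enormD _ _); rewrite E addrK.
have S7 : M * e / beta' = e / beta' + D * b%:R ^+ 2 * e / beta'.
  by rewrite /M; ring.
by move: sep S5 S6 S7; clear; lra.
Qed.

End SpecialCore.

Section SpecialStep.
Variables (R : realType) (k : nat).
Local Notation d := k.+1.
Local Notation N := (@euclidean_norm R d).
Local Notation C := (@simplex_const R d).

Lemma expr_unbounded (b : nat) (z : R) : (2 <= b)%N -> exists n, z <= b%:R ^+ n.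
Proof.
move=> b2; exists (Num.truncn `|z|).+1; apply: le_trans (ler_norm z) _.
have /andP[_ /ltW /le_trans] := truncn_itv (normr_ge0 z); apply.
by rewrite -natrX ler_nat ltnW// ltn_expl.
Qed.

(** It matters that [n] is chosen before the cube: this bounds the scales lost at each interruption.
    Cubes found at a smaller depth are refined by [good_chain] to the common one. The denominator
    [q] is not low for the given cube, so successive interruptions use unbounded denominators. *)
Lemma special_step (b : nat) (e c : R) :
  let e1 := bad_const R d b in
  let M := 1 + d%:R * b%:R ^+ 2 in let kappa := e1 / (4 * d%:R) in
  let A' := 2 ^+ k * (3 * (2 * d%:R) ^+ d / e1 ^+ d.+1) in
  (0 < k)%N -> ((4 * d).+1 < b)%N -> 0 < e -> 0 < c -> c <= 1 -> e <= c ->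
  2 * e <= e1 -> 2 * d%:R * b%:R ^+ 2 * e <= c ^+ d.+1 ->
  A' ^+ 2 * M ^+ k * c <= 1 -> A' ^+ 2 * (M * e) <= kappa ^+ k -> M * e <= 1 ->
  exists n : nat, forall h (a : 'rV[R]_d), 0 < h -> h <= 1 -> good b e h a ->
    exists a', [/\ cube a' (h / b%:R ^+ n) `<=` cube a h,
      good b e (h / b%:R ^+ n) a' &
      exists2 q : nat, 1 <= (C b * h) ^+ d * q%:R ^+ d.+1 &
        forall y, cube a' (h / b%:R ^+ n) y -> exists p,
          q%:R * N (q%:R *: y - map_mx intr p) ^+ d <= (e * (1 + e ^+ d)) ^+ d].
Proof.
move=> e1 M kappa A' k0 bd e0 c0 c1 ec He1 He2 H1 H2 H3.
have bn : (0 < b)%N by apply: leq_ltn_trans bd.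
have b2 : (2 <= b)%N by apply: leq_ltn_trans bd.
have B0 : 0 < b%:R :> R by rewrite ltr0n.
have B2 : 2 <= b%:R :> R by rewrite (ler_nat R 2).
have B1 : 1 <= b%:R :> R by rewrite (ler_nat R 1).
set D : R := d%:R in He2 M kappa H1 H2 H3 *.
have D1 : 1 <= D by rewrite /D (ler_nat R 1).
have D0 : 0 < D by rewrite (lt_le_trans ltr01).
have C1 : 1 <= C b by exact: simplex_const_ge1.
have C0 : 0 < C b by rewrite (lt_le_trans ltr01).
have e10 : 0 < e1 by exact: bad_const_gt0.
have ee1 : e <= e1 by move: e0 He1; clear; lra.
have e_1 : e <= 1 by rewrite (le_trans ec).
pose mV := 1 + (c / e) ^+ d * e.
have mV0 : 0 <= mV by rewrite /mV addr_ge0// mulr_ge0 ?exprn_ge0 ?divr_ge0 ?(ltW c0) ?(ltW e0).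
have A'0 : 0 <= A'.
  apply: mulr_ge0; first exact: exprn_ge0.
  apply: divr_ge0; last by apply: exprn_ge0; exact: ltW.
  by apply: mulr_ge0 => //; apply: exprn_ge0; apply: mulr_ge0 => //; exact: ltW.
pose W := 1 + 3 * (A' * mV) * mV / e1.
have W'0 : 0 <= 3 * (A' * mV) * mV / e1.
  by rewrite divr_ge0 ?(ltW e10)// mulr_ge0// mulr_ge0// mulr_ge0.
have W1 : 1 <= W by rewrite /W lerDl.
have HW : 3 * (A' * mV) * mV / e1 <= W by rewrite /W lerDr.
clearbody W.
have W0 : 0 < W by rewrite (lt_le_trans ltr01).
pose Y := 2 * b%:R ^+ 3 * D / e.
have Y1 : 1 <= Y.
  rewrite /Y ler_pdivlMr// mul1r (le_trans e_1)// -[leLHS]mulr1 ler_pM//.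
  by rewrite -[leLHS]mulr1 ler_pM ?exprn_ege1// (ler_nat R 1 2).
have HY : 2 * b%:R ^+ 3 * D / e <= Y by [].
clearbody Y.
have Y0 : 0 < Y by rewrite (lt_le_trans ltr01).
(* From [n^(d+1) >= Z / h] and [beta >= e n / d] there follows [h beta^(d+1) >= Y^(d+1)]. *)
pose Z := (Y * D / e) ^+ d.+1.
have Z1 : 1 <= Z.
  rewrite exprn_ege1// ler_pdivlMr// mul1r (le_trans e_1)//.
  by rewrite -[leLHS]mulr1 ler_pM.
have Z0 : 0 < Z by rewrite (lt_le_trans ltr01).
pose Z2 : R := 2 ^+ d.+1 * Z.
have Z20 : 0 < Z2 by rewrite mulr_gt0// exprn_gt0.
pose V := c / e; have V0 : 0 < V by rewrite divr_gt0.
(* The depth [n1] makes [x] avoid denominators up to [W q], and [n2] bounds the depth of the cube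
   given by [special_core]; neither depends on [h]. *)
have [n1 Hn1] := expr_unbounded (W ^+ d.+1 * Z2 * C b) b2.
have [n2 Hn2] := expr_unbounded (V ^+ d.+1 * Z2 / (b%:R * e)) b2.
exists n2.+1 => h a h0 h1 ga.
(* The subcube with all indices 1 has margin at least [h / b] on every side, as [b >= 3]. *)
pose a1 : 'rV[R]_d := \row_i (a 0 i + h / b%:R).
have hb0 : 0 < h / b%:R by rewrite divr_gt0.
have [x0 xsub] := fresh_chain a1 n1 (ltn0Sn k) bd hb0.
set h' := h / b%:R / b%:R ^+ n1.+1 in xsub *; rewrite divfK ?gt_eqF// => fresh.
have h'0 : 0 < h' by rewrite divr_gt0// exprn_gt0.
have xx0 := cube_corner x0 (ltW h'0).
move: x0 xx0 fresh xsub => x xx {}fresh xsub; have {fresh} Hx := fresh _ xx.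
have xin i : a 0 i + h / b%:R <= x 0 i <= a 0 i + h - h / b%:R.
  have := xsub _ xx i; rewrite mxE.
  have : 3 * (h / b%:R) <= h.
    rewrite mulrCA ler_piMr ?(ltW h0)// ler_pdivrMr// mul1r (ler_nat R 3).
    by apply: leq_ltn_trans bd.
  by clear; move=> H /andP[? ?]; apply/andP; split; lra.
have xa : cube a h x.
  by move=> i; have := xin i; move: hb0; clear => ? /andP[? ?]; apply/andP; split; lra.
have Zh1 : 1 <= Z / h by rewrite ler_pdivlMr// mul1r (le_trans h1).
have [n [q [p [n0 /andP[nZ nZ2] /andP[q0 qn] lhi minq]]]] := good_approximation x Zh1.
have n0' : 0 < n%:R :> R by rewrite ltr0n.
have q0' : 0 < q%:R :> R by rewrite ltr0n.
have qn' : q%:R <= n%:R ^+ d :> R by rewrite -natrX ler_nat.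
have {}nZ2 : n%:R ^+ d.+1 <= Z2 / h by rewrite /Z2 -mulrA.
have HF Q : (0 < Q)%N -> Q%:R <= W * q%:R ->
    (Q%:R ^+ d.+1 * (C b * h) ^+ d < 1 /\ avoid e Q x) \/ avoid e1 Q x.
  move=> Q0 QW; have [low|high] := ltP (Q%:R ^+ d.+1 * (C b * h) ^+ d) 1.
    by left; split=> //; exact: ga.
  right; apply: Hx; first by rewrite mulrC.
  have Q1 : Q%:R ^+ d.+1 <= (W ^+ d.+1 * (Z2 / h)) ^+ d.
    apply: le_trans (_ : (W * q%:R) ^+ d.+1 <= _).
      by rewrite lerXn2r ?nnegrE ?mulr_ge0 ?(ltW W0).
    rewrite exprMn [leRHS]exprMn ler_pM ?exprn_ge0 ?(ltW W0) ?(ltW q0')//.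
      by rewrite -[leLHS]expr1 ler_weXn2l// exprn_ege1.
    apply: le_trans (_ : (n%:R ^+ d) ^+ d.+1 <= _).
      by rewrite lerXn2r ?nnegrE ?exprn_ge0.
    by rewrite exprAC lerXn2r ?nnegrE ?exprn_ge0 ?divr_ge0 ?(ltW Z20) ?(ltW h0).
  apply: le_lt_trans (ler_wpM2r _ Q1) _; first by rewrite exprn_ge0// mulr_ge0// ltW.
  rewrite -exprMn expr_lt1//; last first.
    exact: mulr_ge0 (mulr_ge0 (exprn_ge0 _ (ltW W0)) (divr_ge0 (ltW Z20) (ltW h0)))
      (mulr_ge0 (ltW C0) (ltW h'0)).
  rewrite [ltLHS](_ : _ = W ^+ d.+1 * Z2 * C b / (b%:R * b%:R ^+ n1.+1)); last first.
    have X : b%:R ^+ n1.+1 != 0 :> R by rewrite gt_eqF// exprn_gt0.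
    rewrite /h'; move: (b%:R ^+ n1.+1) (W ^+ d.+1) X => X1 X2 X.
    by field; rewrite X !gt_eqF.
  rewrite ltr_pdivrMr ?mulr_gt0 ?exprn_gt0// mul1r (le_lt_trans Hn1)//.
  by rewrite -exprS ltr_eXn2l//; move: B2; clear; lra.
have [beta b0 bq] := pos_root_exists R (ltn0Sn k) q0.
set l := N (q%:R *: x - map_mx intr p) in lhi.
have l0 : 0 <= l by exact: enorm_ge0.
have bn' : beta <= n%:R.
  rewrite leNgt; apply/negP => H; move: qn'; rewrite leNgt -bq => /negP; apply.
  by rewrite ltr_pXn2r ?nnegrE ?(ltW b0).
have hi : beta * l <= D.
  apply: le_trans (ler_wpM2l (ltW b0) lhi) _.
  by rewrite mulrCA ler_piMr ?(ltW D0)// ler_pdivrMr// mul1r.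
have qW : q%:R <= W * q%:R by rewrite ler_peMl// ltW.
(* A bootstrap: the weak bound [e <= beta l] already makes [beta] large, so [q] is not low for [h],
   and [HF] then yields the bound with [e1]. *)
have elow : e <= beta * l.
  have avq : avoid e q x.
    by case: (HF q q0 qW) => [[]//|]; apply: avoid_le => //; exact: ltW.
  move: avq => /(avoid_root _ (ltn0Sn k) (ltW e0) b0 bq) /(_ p).
  by rewrite -/l ler_pdivrMr// mulrC.
have Yb : Y ^+ d.+1 <= h * beta ^+ d.+1.
  have bl : e * n%:R / D <= beta.
    rewrite ler_pdivrMr// -ler_pdivlMr// (le_trans elow)//.
    by rewrite -mulrA ler_pM2l.
  apply: (@le_trans _ _ (h * (e * n%:R / D) ^+ d.+1)); last first.
    rewrite ler_pM2l// lerXn2r ?nnegrE ?(ltW b0)//.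
    by rewrite divr_ge0 ?mulr_ge0 ?(ltW e0) ?(ltW D0).
  have -> : Y ^+ d.+1 = h * ((e / D) ^+ d.+1 * (Z / h)).
    have -> : Y = (e / D) * (Y * D / e) by field; rewrite !gt_eqF.
    rewrite exprMn -/Z; move: (_ ^+ d.+1) => X.
    by field; rewrite gt_eqF.
  rewrite ler_pM2l// (_ : e * n%:R / D = e / D * n%:R); last by ring.
  rewrite [leRHS]exprMn ler_wpM2l// exprn_ge0//.
  by rewrite divr_ge0// ltW.
have hb1 : 1 <= h * beta ^+ d.+1 by rewrite (le_trans _ Yb)// exprn_ege1.
have high : 1 <= q%:R ^+ d.+1 * (C b * h) ^+ d.
  rewrite leNgt (low_root (ltn0Sn k) _ b0 bq) ?mulr_ge0 ?(ltW C0) ?(ltW h0)// -leNgt.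
  by rewrite mulrCA -[leLHS]mulr1 ler_pM// mulrC.
have lo : e1 <= beta * l.
  case: (HF q q0 qW) => [[]|]; first by rewrite ltNge high.
  move=> /(avoid_root _ (ltn0Sn k) (ltW e10) b0 bq) /(_ p).
  by rewrite -/l ler_pdivrMr// mulrC.
have [m [xs]] := @special_core R k b e c W Y h beta a x q p k0 bd e0 c0 c1 ec
  He1 He2 H1 H2 H3 HW W1 HY h0 h1 ga xin HF b0 bq lo hi Yb minq.
rewrite -/V /=; set T := h / b%:R ^+ m => -[sub Tlo hit low].
have T0 : 0 < T by rewrite divr_gt0// exprn_gt0.
have Vb0 : 0 < V * beta by rewrite mulr_gt0.
have mn2 : (m <= n2)%N.
  have : (b%:R : R) ^+ m <= b%:R ^+ n2.
    apply: le_trans Hn2; rewrite ler_pdivlMr ?mulr_gt0// mulrC.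
    move: Tlo; rewrite /T ler_pdivrMr ?exprn_gt0// mulrAC ler_pdivlMr ?exprn_gt0//.
    move=> /le_trans; apply; rewrite exprMn mulrCA ler_pM2l ?exprn_gt0//.
    rewrite mulrC -ler_pdivlMr//; apply: le_trans nZ2.
    by rewrite lerXn2r ?nnegrE ?(ltW b0).
  by rewrite -!natrX ler_nat leq_exp2l.
(* The lower bound on [T] is what the simplex lemma requires for denominators above [(V beta)^d];
   the others are settled by [low]. *)
have [S [Sb HS]] := @most_children_avoid R d b xs T e (ltn0Sn k) b2 T0.
have [f fS] := step_nonempty bd Sb.
have Tb0 : 0 < T / b%:R by rewrite divr_gt0.
have fsub : cube (child xs T f) (T / b%:R) `<=` cube xs T.
  by apply: cube_child => //; exact: ltW.
have gf : good b e (T / b%:R) (child xs T f).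
  move=> y yc q' q'0 q'low.
  have [le_q'|lt_q'] := leP q'%:R ((V * beta) ^+ d).
    by apply: low le_q' => //; exact: fsub.
  apply: HS yc _ _ q'low => //.
  apply: (@le_trans _ _ ((e / (V * beta) ^+ d.+1) ^+ d * ((V * beta) ^+ d) ^+ d.+1)).
    rewrite exprAC -exprMn divfK// gt_eqF// exprn_gt0//.
  have eT : e / (V * beta) ^+ d.+1 <= T / b%:R.
    by rewrite ler_pdivlMr// mulrC mulrA.
  have E0 : 0 <= e / (V * beta) ^+ d.+1 by rewrite divr_ge0 ?exprn_ge0 ?(ltW e0) ?(ltW Vb0).
  rewrite ler_pM ?exprn_ge0 ?(ltW Vb0)//.
    by rewrite lerXn2r ?nnegrE ?(ltW Tb0).
  by rewrite lerXn2r ?nnegrE ?exprn_ge0 ?(ltW Vb0) ?(ltW lt_q').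
have [a' a'sub ga'] := good_chain (n2 - m) (ltn0Sn k) bd Tb0 (ltW e0) ee1 gf.
have TE : T / b%:R / b%:R ^+ (n2 - m) = h / b%:R ^+ n2.+1.
  have -> : b%:R ^+ n2.+1 = b%:R ^+ m * (b%:R * b%:R ^+ (n2 - m)) :> R.
    by rewrite -exprS -exprD addnS subnKC.
  by rewrite /T !invfM !mulrA.
rewrite TE in a'sub ga'; exists a'; split=> //.
  by apply: subset_trans a'sub _; apply: subset_trans fsub _.
exists q; first by rewrite mulrC.
move=> y /a'sub /fsub /hit yh; exists p; rewrite -bq -exprMn.
rewrite lerXn2r ?nnegrE ?mulr_ge0 ?enorm_ge0 ?(ltW b0) ?(ltW e0)//.
  by rewrite addr_ge0// exprn_ge0// ltW.
by rewrite bq.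
Qed.

End SpecialStep.

(** * Cantor construction *)

Section NestedCubes.
Variables (R : realType) (d : nat).

Lemma nested_cubes_meet (a : nat -> 'rV[R]_d) (h : nat -> R) :
  (forall i, 0 <= h i) ->
  (forall i, cube (a i.+1) (h i.+1) `<=` cube (a i) (h i)) ->
  exists x, forall i, cube (a i) (h i) x.
Proof.
move=> h0 sub.
have subk i k : cube (a (i + k)%N) (h (i + k)%N) `<=` cube (a i) (h i).
  elim: k => [|k IH]; first by rewrite addn0.
  by rewrite addnS; apply: subset_trans IH; exact: sub.
have bnd i l j : a l 0 j <= a i 0 j + h i.
  have [il|/ltnW li] := leqP i l.
    by rewrite -(subnKC il); have /andP[] := subk i (l - i)%N _ (cube_corner _ (h0 _)) j.
  have /andP[+ _] := subk l (i - l)%N _ (cube_corner _ (h0 _)) j.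
  rewrite subnKC// => /le_trans; apply.
  by rewrite lerDl.
exists (\row_j sup (range (fun i => a i 0 j))) => i j; rewrite mxE.
apply/andP; split.
  apply: ub_le_sup; last by exists i.
  by exists (a 0%N 0 j + h 0%N) => _ [l _ <-].
by apply: ge_sup; [exists (a 0%N 0 j), 0%N | move=> _ [l _ <-]].
Qed.

End NestedCubes.

Section Mass.
Variables (R : realType) (d b : nat) (U : nat -> set 'rV[R]_d) (w : nat -> \bar R).
Hypothesis w_gt0 : forall i, (0 < w i)%E.
Hypothesis b2 : (2 <= b)%N.

Definition mass (A : set 'rV[R]_d) : \bar R :=
  (\sum_(0 <= i <oo) (if `[< U i `&` A !=set0 >] then w i else 0))%E.

Let term_ge0 (A : set 'rV[R]_d) i :
  (0 <= (if `[< U i `&` A !=set0 >] then w i else 0))%E.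
Proof. by case: ifP => // _; exact: ltW. Qed.

Lemma mass_mono A B : A `<=` B -> (mass A <= mass B)%E.
Proof.
move=> AB; apply: lee_nneseries => i _ //.
case: asboolP => [[x [Ux Ax]]|_]; last exact: term_ge0.
by rewrite asboolT//; exists x; split => //; exact: AB.
Qed.

Lemma weight_le_mass A i x : U i x -> A x -> (w i <= mass A)%E.
Proof.
move=> Ux Ax; apply: le_trans (nneseries_lim_ge i.+1 _); last by [].
rewrite big_mkord (bigD1 (ord_max : 'I_i.+1))//= asboolT; last by exists x.
by rewrite leeDl// sume_ge0.
Qed.

Lemma card_children_meeting (a : 'rV[R]_d) (h : R) (B : set 'rV[R]_d) : 0 < h ->
  (forall x y, B x -> B y -> forall j, `|x 0 j - y 0 j| <= h / b%:R) ->
  (#|finset (fun c : {ffun 'I_d -> 'I_b} =>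
      `[< B `&` cube (child a h c) (h / b%:R) !=set0 >])| <= 5 ^ d)%N.
Proof.
move=> h0 diamB; set S := finset _.
have b0 : 0 < b%:R :> R by rewrite ltr0n; exact: leq_trans b2.
set g := h / b%:R in diamB *; have g0 : 0 < g by rewrite divr_gt0.
have [->|[c0]] := set_0Vmem S; first by rewrite cards0.
rewrite inE => /asboolP[x0 [Bx0 _]].
(* The shift by 1/2 centres the subcube: the index deviates by at most 3/2, hence by at most 2,
   which leaves 5 values. *)
pose T i := finset (fun t : 'I_b => `|t%:R - ((x0 0 i - a 0 i) / g - 2^-1)| <= 2 :> R).
apply: (@leq_trans #|family T|).
  apply/subset_leq_card/fintype.subsetP => c; rewrite inE => /asboolP[x [Bx xc]].
  apply/familyP => i; rewrite inE.
  have := xc i; rewrite mxE => /andP[x1 x2]; have dB := diamB _ _ Bx Bx0 i.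
  rewrite -(ler_pM2l g0) -[X in X * `|_|](gtr0_norm g0) -normrM.
  have -> : g * ((c i)%:R - ((x0 0 i - a 0 i) / g - 2^-1)) =
     g * (c i)%:R - (x0 0 i - a 0 i) + g / 2 by field; rewrite gt_eqF.
  rewrite -/g in x1 x2; move: x1 x2 g0 dB; clear; rewrite !ler_norml.
  by move=> x1 x2 g0 /andP[h1 h2]; apply/andP; split; lra.
rewrite card_family foldrE big_map big_enum/=.
apply: (@leq_trans (\prod_(i < d) 5)%N); last by rewrite prod_nat_const card_ord.
apply: leq_prod => i _; apply: (@card_ord_near R _ (T i) ((x0 0 i - a 0 i) / g - 2^-1) 2) => t.
by rewrite inE.
Qed.

(** Averaging. A set meeting the cube has weight at most [z], hence is small and is counted in at
    most [5^d] subcubes. The masses of the subcubes thus add up to at most [5^d z], too little for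
    every member of [S] to exceed [t z / 2]. *)
Lemma light_child (a : 'rV[R]_d) (h z t : R) (S : {set {ffun 'I_d -> 'I_b}}) :
  0 < h -> 0 < z -> 2 * 5 ^+ d < #|S|%:R * t ->
  (forall i, (w i <= z%:E)%E -> forall x y, U i x -> U i y ->
     forall j, `|x 0 j - y 0 j| <= h / b%:R) ->
  (mass (cube a h) <= z%:E)%E ->
  exists2 c, c \in S & (mass (cube (child a h c) (h / b%:R)) <= (t / 2 * z)%:E)%E.
Proof.
move=> h0 z0 St diamU mz; apply: contrapT => no.
have heavy c : c \in S -> ((t / 2 * z)%:E <= mass (cube (child a h c) (h / b%:R)))%E.
  by move=> cS; rewrite leNgt; apply/negP => H; apply: no; exists c => //; exact: ltW.
have : (\sum_(c in S) mass (cube (child a h c) (h / b%:R)) <= (5 ^+ d * z)%:E)%E.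
  rewrite -nneseries_sum; last by move=> c i _; exact: term_ge0.
  apply: (@le_trans _ _ (\sum_(0 <= i <oo) ((5 ^+ d)%:E *
      (if `[< U i `&` cube a h !=set0 >] then w i else 0)))%E); last first.
    rewrite nneseriesZl; last by move=> i _; exact: term_ge0.
    by rewrite EFinM; apply: lee_wpmul2l; rewrite // lee_fin exprn_ge0.
  apply: lee_nneseries => [i _ _|i _].
    by apply: sume_ge0 => c _; exact: term_ge0.
  rewrite -big_mkcondr/=.
  have [Ui|nUi] := pselect (U i `&` cube a h !=set0); last first.
    rewrite asboolF// mule0 big1// => c /andP[_ /asboolP[x [Ux xc]]].
    exfalso; apply: nUi; exists x; split => //; apply: cube_child xc; last exact: ltW.
    exact: leq_trans b2.
  rewrite asboolT//; have wz : (w i <= z%:E)%E.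
    by case: Ui => x [Ux xa]; apply: le_trans mz; exact: weight_le_mass Ux xa.
  have [r wr] : exists r : R, w i = r%:E.
    by move: (w_gt0 i) wz; case: (w i) => // r _ _; exists r.
  have r0 : 0 <= r by have := w_gt0 i; rewrite wr lte_fin => /ltW.
  rewrite wr sumEFin -EFinM lee_fin sumr_const -[leLHS]mulr_natl ler_wpM2r//.
  rewrite -natrX ler_nat.
  apply: leq_trans (card_children_meeting a h0 (diamU _ wz)).
  apply/subset_leq_card/fintype.subsetP => c H; rewrite inE; apply/asboolP.
  by move: H; rewrite unfold_in => /andP[_ /asboolP].
apply/negP; rewrite -ltNge.
apply: (@lt_le_trans _ _ (\sum_(c in S) (t / 2 * z)%:E)%E); last exact: lee_sum.
rewrite sumEFin lte_fin sumr_const -[ltRHS]mulr_natl mulrA ltr_pM2r//.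
by move: St => ?; lra.
Qed.

End Mass.

Section Cantor.
Variables (R : realType) (k b : nat) (e t : R).
Variables (U : nat -> set 'rV[R]_k.+1) (w : nat -> \bar R).
Local Notation d := k.+1.
Local Notation N := (@euclidean_norm R d).
Local Notation C := (@simplex_const R d).
Local Notation side n := ((b%:R ^+ n)^-1 : R).
Local Notation mass := (mass U w).
Hypothesis w_gt0 : forall i, (0 < w i)%E.
Hypothesis bd : ((4 * d).+1 < b)%N.
Hypothesis e_gt0 : 0 < e.
Hypothesis e_le : e <= bad_const R d b.
Hypothesis t_gt0 : 0 < t.
Hypothesis t_lt1 : t < 1.
Hypothesis many : 2 * 5 ^+ d < b%:R ^+ k * (b%:R - (4 * d).+1%:R) * t.
Hypothesis diamU : forall i n, (w i <= (t ^+ n)%:E)%E ->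
  forall x y, U i x -> U i y -> forall j, `|x 0 j - y 0 j| <= side n.

Let b2 : (2 <= b)%N. Proof. by apply: leq_ltn_trans bd. Qed.
Let b_gt0 : 0 < b%:R :> R. Proof. by rewrite ltr0n; exact: leq_trans b2. Qed.
Let side_gt0 n : 0 < side n. Proof. by rewrite invr_gt0 exprn_gt0. Qed.
Let sideD m n : side m / b%:R ^+ n = side (m + n).
Proof. by rewrite -invfM exprD. Qed.
Let sideS n : side n / b%:R = side n.+1.
Proof. by rewrite -(expr1 b%:R) sideD addn1. Qed.
Let C_gt0 : 0 < C b.
Proof. by apply: lt_le_trans (simplex_const_ge1 _ _ _); rewrite // (leq_trans _ b2). Qed.

(** At least [b^k (b - (4 d + 1))] subcubes survive the simplex lemma, enough by [many]. The mass
    drops by [t / 2] where [t] would do; the extra factor is the reserve spent in [macro_step]. *)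
Lemma normal_step n a z : 0 < z -> z <= t ^+ n.+1 -> good b e (side n) a ->
  (mass (cube a (side n)) <= z%:E)%E ->
  exists a', [/\ cube a' (side n.+1) `<=` cube a (side n),
    good b e (side n.+1) a' & (mass (cube a' (side n.+1)) <= (t / 2 * z)%:E)%E].
Proof.
move=> z0 zt ga ma.
have [S [Sb HS]] := good_step (ltn0Sn k) b2 (side_gt0 n) (ltW e_gt0) e_le ga.
have St : 2 * 5 ^+ d < #|S|%:R * t.
  apply: lt_le_trans many _; rewrite ler_pM2r//.
  have Sc : (#|~: S| <= (4 * d).+1 * b ^ k)%N.
    move: Sb; rewrite expnSr mulnA leq_mul2r => /orP[/eqP b0|//].
    by exfalso; move: b2; rewrite b0.
  have := cardsC S; rewrite card_ffun !card_ord => SS.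
  have : ((b ^ d)%:R <= #|S|%:R + ((4 * d).+1 * b ^ k)%:R :> R).
    by rewrite -natrD ler_nat -SS leq_add2l.
  rewrite natrM !natrX exprSr => H.
  by rewrite mulrBr lerBlDr (mulrC (b%:R ^+ k) (_.+1)%:R).
have [|c cS mc] := light_child w_gt0 b2 (side_gt0 n) z0 St _ ma.
  move=> i wz x y Ux Uy j; rewrite sideS; apply: diamU Ux Uy j.
  by apply: le_trans wz _; rewrite lee_fin.
exists (child a (side n) c); rewrite -sideS; split => //; last exact: HS.
by apply: cube_child; [exact: leq_trans b2|exact: ltW].
Qed.

Lemma normal_run n a z L : 0 < z -> z <= t ^+ n.+1 -> good b e (side n) a ->
  (mass (cube a (side n)) <= z%:E)%E ->
  exists a', [/\ cube a' (side (n + L)) `<=` cube a (side n),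
    good b e (side (n + L)) a' &
    (mass (cube a' (side (n + L))) <= ((t / 2) ^+ L * z)%:E)%E].
Proof.
move=> z0 zt ga ma; elim: L => [|L [a' [sub ga' ma']]].
  by exists a; rewrite addn0 expr0 mul1r; split.
have t2 : 0 < t / 2 by rewrite divr_gt0.
have [||a'' [sub' ga'' ma'']] := normal_step _ _ ga' ma'.
- by rewrite mulr_gt0// exprn_gt0.
- rewrite -addSn addnC exprD; apply: ler_pM => //.
  + by rewrite exprn_ge0// ltW.
  + exact: ltW.
  + by rewrite lerXn2r ?nnegrE ?(ltW t2) ?(ltW t_gt0)// ler_pdivrMr// ler_peMr ?(ltW t_gt0)// (ler_nat R 1 2).
exists a''; rewrite addnS [(t / 2) ^+ L.+1]exprS -mulrA; split => //.
exact: subset_trans sub' sub.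
Qed.

Definition approximated (q0 : nat -> Prop) (x : 'rV[R]_d) :=
  exists2 q, q0 q & exists p,
    q%:R * N (q%:R *: x - map_mx intr p) ^+ d <= (e * (1 + e ^+ d)) ^+ d.

Hypothesis special : exists s : nat, forall h (a : 'rV[R]_d), 0 < h -> h <= 1 ->
  good b e h a ->
    exists a', [/\ cube a' (h / b%:R ^+ s) `<=` cube a h,
      good b e (h / b%:R ^+ s) a' &
      exists2 q : nat, 1 <= (C b * h) ^+ d * q%:R ^+ d.+1 &
        forall y, cube a' (h / b%:R ^+ s) y -> exists p,
          q%:R * N (q%:R *: y - map_mx intr p) ^+ d <= (e * (1 + e ^+ d)) ^+ d].

(** A special step descends [s] levels without any control of the mass. It is preceded by [L] normal
    steps with [2^-L <= t^s], whose reserve restores the invariant [t^(n+1)] at the new depth. *)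
Lemma macro_step n a : good b e (side n) a ->
  (mass (cube a (side n)) <= (t ^+ n.+1)%:E)%E ->
  exists n' a', [/\ (n < n')%N, cube a' (side n') `<=` cube a (side n),
    good b e (side n') a', (mass (cube a' (side n')) <= (t ^+ n'.+1)%:E)%E &
    forall y, cube a' (side n') y ->
      approximated (fun q => 1 <= (C b * side n) ^+ d * q%:R ^+ d.+1) y].
Proof.
move=> ga ma; have [s Hs] := special.
have [L L0 HL] : exists2 L, (0 < L)%N & 2^-1 ^+ L <= t ^+ s :> R.
  have [L HL] := expr_unbounded (t ^+ s)^-1 (leqnn 2); exists L.+1 => //.
  rewrite exprVn -[leRHS]invrK lef_pV2 ?posrE ?exprn_gt0 ?invr_gt0 ?exprn_gt0//.
  by rewrite (le_trans HL)// exprS ler_peMl ?exprn_ge0// (ler_nat R 1 2).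
have [||a1 [sub1 ga1 ma1]] := normal_run L _ _ ga ma => //.
  by rewrite exprn_gt0.
have [|a' [sub' ga' [q q1 qy]]] := Hs (side (n + L)) a1 (side_gt0 _) _ ga1.
  by rewrite invf_le1 ?exprn_gt0// exprn_ege1// (ler_nat R 1); exact: leq_trans b2.
rewrite sideD in sub' ga' qy; exists (n + L + s)%N, a'; split => //.
- by rewrite -addnA -[ltnLHS]addn0 ltn_add2l addn_gt0 L0.
- exact: subset_trans sub' sub1.
- apply: le_trans (mass_mono U w_gt0 sub') _; apply: le_trans ma1 _; rewrite lee_fin.
  rewrite exprMn -addnA -addSn exprD exprD mulrC ler_pM2l ?exprn_gt0//.
  by rewrite ler_pM2l ?exprn_gt0.
- move=> y yc; exists q; last exact: qy.
  apply: le_trans q1 _; rewrite ler_wpM2r ?exprn_ge0//.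
  rewrite lerXn2r ?nnegrE ?mulr_ge0 ?(ltW C_gt0) ?(ltW (side_gt0 _))//.
  rewrite ler_pM2l// lef_pV2 ?posrE ?exprn_gt0// exprD ler_peMr ?exprn_ge0//.
  by rewrite exprn_ege1// (ler_nat R 1); exact: leq_trans b2.
Qed.

Lemma eventually_low q : exists n0, forall n, (n0 <= n)%N ->
  q%:R ^+ d.+1 * (C b * side n) ^+ d < 1.
Proof.
have [n0 Hn0] := expr_unbounded (C b * (q%:R ^+ d.+1 + 2)) b2.
exists n0 => n n0n; have bn0 : 0 < b%:R ^+ n :> R by rewrite exprn_gt0.
have q0 : 0 <= q%:R ^+ d.+1 :> R by rewrite exprn_ge0.
have {}Hn : C b * (q%:R ^+ d.+1 + 2) <= b%:R ^+ n.
  by apply: le_trans Hn0 _; rewrite ler_weXn2l// (ler_nat R 1); exact: leq_trans b2.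
have X0 : 0 <= C b * side n by rewrite divr_ge0 ?(ltW C_gt0) ?(ltW bn0).
have q2 : 0 < q%:R ^+ d.+1 + 2 :> R by move: q0; lra.
have X1 : C b * side n <= (q%:R ^+ d.+1 + 2)^-1.
  by rewrite ler_pdivrMr// [leRHS]mulrC ler_pdivlMr.
have X2 : (q%:R ^+ d.+1 + 2)^-1 <= 1 :> R by rewrite invf_le1; move: q0; lra.
apply: (@le_lt_trans _ _ (q%:R ^+ d.+1 * (q%:R ^+ d.+1 + 2)^-1)).
  rewrite ler_wpM2l//; apply: (le_trans _ X1); rewrite -[leRHS]expr1 ler_wiXn2l//.
  exact: le_trans X1 X2.
by rewrite ltr_pdivrMr; move: q0; lra.
Qed.

Lemma cantor_point : (mass setT <= t%:E)%E ->
  exists x, [/\ forall q, (0 < q)%N -> avoid e q x,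
    forall m, approximated (fun q => (m < q)%N) x & forall i, ~ U i x].
Proof.
move=> mT.
pose P (s : nat * 'rV[R]_d) := good b e (side s.1) s.2 /\
  (mass (cube s.2 (side s.1)) <= (t ^+ s.1.+1)%:E)%E.
pose Q (s s' : nat * 'rV[R]_d) := [/\ (s.1 < s'.1)%N,
  cube s'.2 (side s'.1) `<=` cube s.2 (side s.1), P s' &
  forall y, cube s'.2 (side s'.1) y ->
      approximated (fun q => 1 <= (C b * side s.1) ^+ d * q%:R ^+ d.+1) y].
have next s : {s' | P s -> Q s s'}.
  (* The default [s] is returned only where [P] fails, which never happens along the sequence. *)
  apply: cid; have [[g m]|nP] := pselect (P s); last by exists s.
  by have [n' [a' [? ? ? ? ?]]] := macro_step g m; exists (n', a').
have [f [f0 fQ]] := dependent_choice next (0%N, 0).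
have P0 : P (f 0%N).
  rewrite f0; split => /=.
    move=> x _ q q0; rewrite expr0 invr1 mulr1 ltNge => /negP[].
    rewrite -[leLHS]mulr1 ler_pM// exprn_ege1 ?(ler_nat R 1)// simplex_const_ge1//.
    exact: leq_trans b2.
  rewrite expr1; apply: le_trans mT; apply: mass_mono => //.
have Pf i : P (f i) by elim: i => // i /fQ [].
have {}fQ i : Q (f i) (f i.+1) by apply: fQ.
have fn i : (i <= (f i).1)%N.
  by elim: i => // i IH; have [lt _ _ _] := fQ i; exact: leq_ltn_trans lt.
have [x xc] : exists x, forall i, cube (f i).2 (side (f i).1) x.
  apply: nested_cubes_meet => i; first exact: ltW.
  by have [] := fQ i.
exists x; split.
- move=> q q0; have [n0 Hn0] := eventually_low q.
  exact: (Pf n0).1 (xc n0) _ q0 (Hn0 _ (fn n0)).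
(* At depth [n0] every denominator up to [m] is low, and the one provided there is not, so it
   exceeds [m]. *)
- move=> m; have [n0 Hn0] := eventually_low m.
  have [_ _ _ /(_ x (xc _)) [q q1 qp]] := fQ n0; exists q => //.
  rewrite ltnNge; apply/negP => qm; move: q1; rewrite leNgt => /negP; apply.
  apply: le_lt_trans (Hn0 _ (fn n0)); rewrite mulrC ler_wpM2r ?exprn_ge0//.
    by rewrite mulr_ge0 ?(ltW C_gt0) ?(ltW (side_gt0 _)).
  by rewrite lerXn2r ?nnegrE// ler_nat.
(* A set containing [x] meets all cubes of the sequence, so its weight is below every [t^n], against
   the positivity of the weights. *)
- move=> i Uix; have wle n : (w i <= (t ^+ n)%:E)%E.
    apply: le_trans (weight_le_mass w_gt0 Uix (xc n)) _.
    apply: le_trans (Pf n).2 _; rewrite lee_fin ler_wiXn2l ?(ltW t_gt0) ?(ltW t_lt1)//.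
    by rewrite leqW// fn.
  have [r wr] : exists r : R, w i = r%:E.
    by move: (w_gt0 i) (wle 0%N); case: (w i) => // r _ _; exists r.
  have r0 : 0 < r by have := w_gt0 i; rewrite wr lte_fin.
  have [n Hn] : exists n, (t ^+ n < r).
    have tn : `|t| < 1 by rewrite gtr0_norm.
    have /cvgrPdist_lt := cvg_expr tn; move=> /(_ r r0) [n _ /(_ n (leqnn n))]; rewrite /= sub0r normrN.
    by rewrite ger0_norm ?exprn_ge0 ?(ltW t_gt0)// => ?; exists n.
  by have := wle n; rewrite wr lee_fin leNgt Hn.
Qed.

End Cantor.

(** * The liminf and the Hausdorff dimension *)

Section ThetaBounds.
Variables (R : realType) (k : nat).
Local Notation d := k.+1.
Local Notation N := (@euclidean_norm R d).

Lemma root_nat (q : nat) : (q%:R `^ d%:R^-1) ^+ d = q%:R :> R.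
Proof. by rewrite -powR_mulrn ?powR_ge0// -powRrM mulVf ?powRr1// pnatr_eq0. Qed.

Lemma root_nat_gt0 (q : nat) : (0 < q)%N -> 0 < q%:R `^ d%:R^-1 :> R.
Proof. by move=> q0; rewrite powR_gt0// ltr0n. Qed.

Lemma Theta_ge (e : R) (x : 'rV[R]_d) : 0 <= e ->
  (forall q, (0 < q)%N -> avoid e q x) -> (e%:E <= Theta N x)%E.
Proof.
move=> e0 xav; rewrite /Theta limn_einf_lim.
apply: lime_ge; first exact: is_cvg_einfs.
apply: nearW => n; apply: le_ereal_inf_tmp => _ [m _ <-]; rewrite lee_fin.
have [p ->] := dist_int_euclidean_attained (m.+1%:R *: x).
rewrite mulrC -ler_pdivrMr ?root_nat_gt0//.
exact: (avoid_root _ (ltn0Sn k) e0 (root_nat_gt0 _) (root_nat m.+1)).1 (xav m.+1 isT) p.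
Qed.

Lemma dist_int_le (v : 'rV[R]_d) p : dist_int N v <= N (v - map_mx intr p).
Proof.
apply: ge_inf; last by exists p.
by exists 0 => _ [q _ <-]; exact: enorm_ge0.
Qed.

Lemma Theta_le (E : R) (x : 'rV[R]_d) : 0 <= E ->
  (forall m, exists2 q, (m < q)%N &
    exists p, q%:R * N (q%:R *: x - map_mx intr p) ^+ d <= E ^+ d) ->
  (Theta N x <= E%:E)%E.
Proof.
move=> E0 H; rewrite /Theta limn_einf_lim.
apply: lime_le; first exact: is_cvg_einfs.
apply: nearW => n; have [[//|q] nq [p qp]] := H n.
apply: le_trans (_ : (((q.+1)%:R `^ d%:R^-1 * dist_int N (q.+1%:R *: x))%:E <= _)%E).
  by apply: ereal_inf_lbound; exists q.
rewrite lee_fin; apply: le_trans (ler_wpM2l (powR_ge0 _ _) (dist_int_le _ p)) _.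
rewrite -(@ler_pXn2r _ d) ?nnegrE ?mulr_ge0 ?enorm_ge0 ?powR_ge0//.
by rewrite exprMn root_nat.
Qed.

End ThetaBounds.

(** * Lower bounds for the Hausdorff dimension *)

Section HausdorffLower.
Variables (R : realType) (d : nat).
Local Notation N := (@euclidean_norm R d).

Lemma diameter_ge0 (A : set 'rV[R]_d) : (0 <= diameter A)%E.
Proof. by apply: ereal_sup_ubound; left. Qed.

Lemma diameter_pow_ge0 s (A : set 'rV[R]_d) : (0 <= diameter_pow s A)%E.
Proof. by rewrite /diameter_pow; case: ifP => // _; exact: poweR_ge0. Qed.

Lemma hausdorff_premeasure_ge0 s r (A : set 'rV[R]_d) : (0 <= hausdorff_premeasure s r A)%E.
Proof.
by apply: le_ereal_inf_tmp => _ [U _ <-]; apply: nneseries_ge0 => i _ _; exact: diameter_pow_ge0.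
Qed.

Lemma hausdorff_dim_ge0 (A : set 'rV[R]_d) : (0 <= hausdorff_dim A)%E.
Proof. by apply: le_ereal_inf_tmp => _ [s [s0 _] <-]; rewrite lee_fin. Qed.

Lemma hausdorff_measure_mono s (A B : set 'rV[R]_d) : A `<=` B ->
  (hausdorff_measure s A <= hausdorff_measure s B)%E.
Proof.
move=> AB; apply: ge_ereal_sup => _ [r r0 <-].
apply: le_trans (ereal_sup_ubound _); last by exists r.
apply: ereal_inf_le_tmp => _ [U [BU Ur] <-]; exists U => //; split => //.
exact: subset_trans BU.
Qed.

Lemma hausdorff_dim_mono (A B : set 'rV[R]_d) : A `<=` B ->
  (hausdorff_dim A <= hausdorff_dim B)%E.
Proof.
move=> AB; apply: ereal_inf_le_tmp => _ [s [s0 sB] <-]; exists s => //; split => //.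
apply/eqP; rewrite eq_le -{1}sB hausdorff_measure_mono//=.
apply: le_trans (hausdorff_premeasure_ge0 s 1 A) _.
by apply: ereal_sup_ubound; exists 1 => //=.
Qed.

(* Frostman-type criterion: the sets are weighted by (diam U)^s plus a
   summable positive perturbation, so that even points have positive weight. *)
Lemma hausdorff_dim_ge (b : nat) (s : R) (A : set 'rV[R]_d) : (2 <= b)%N -> 0 < s ->
  (forall (U : nat -> set 'rV[R]_d) (w : nat -> \bar R), (forall i, 0 < w i)%E ->
     (forall i n, (w i <= ((b%:R^-1 `^ s) ^+ n)%:E)%E ->
       forall x y, U i x -> U i y -> forall j, `|x 0 j - y 0 j| <= (b%:R ^+ n)^-1) ->
     (mass U w setT <= (b%:R^-1 `^ s)%:E)%E -> exists2 x, A x & forall i, ~ U i x) ->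
  (s%:E <= hausdorff_dim A)%E.
Proof.
move=> b2 s0 H; apply: le_ereal_inf_tmp => _ [s' [s'0 s'A] <-].
rewrite lee_fin leNgt; apply/negP => s's.
have b0 : 0 < b%:R :> R by rewrite ltr0n; exact: leq_trans b2.
set t := b%:R^-1 `^ s in H *; have t0 : 0 < t by rewrite powR_gt0// invr_gt0.
have t20 : 0 < t / 2 by rewrite divr_gt0.
(* Scale 1 is enough: diameters at most 1 allow the exponent [s'] to be replaced by the larger
   [s]. *)
have : (hausdorff_premeasure s' 1 A < (t / 2)%:E)%E.
  apply: (@le_lt_trans _ _ 0%E); last by rewrite lte_fin.
  by rewrite -s'A; apply: ereal_sup_ubound; exists 1 => //=.
move=> /ereal_inf_lt [_ [U [AU Ud] <-] sumU].
(* The perturbations add up to [t / 2], so the total mass stays below [t]. *)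
pose w i := (diameter_pow s' (U i) + ((t / 2) / (2 ^ i.+1)%:R)%:E)%E.
have w0 i : (0 < w i)%E.
  apply: lt_le_trans (leeDr _ (diameter_pow_ge0 _ _)).
  by rewrite lte_fin divr_gt0// ltr0n expn_gt0.
have [||x Ax nU] := H U w w0.
- move=> i n wn x y Ux Uy j.
  have /ereal_sup_ubound dxy : ([set 0%E] `|` [set (N (z.1 - z.2))%:E | z in U i `*` U i]) (N (x - y))%:E.
    by right; exists (x, y).
  have UN : U i == set0 = false by apply/eqP => U0; move: Ux; rewrite U0.
  have [r rE] : exists r : R, diameter (U i) = r%:E.
    move: (Ud i) (diameter_ge0 (U i)); case: (diameter (U i)) => // r _ _; by exists r.
  have r0 : 0 <= r by have := diameter_ge0 (U i); rewrite rE lee_fin.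
  have r1 : r <= 1 by have := Ud i; rewrite rE lee_fin.
  have xyr : N (x - y) <= r by move: dxy; rewrite -/(diameter (U i)) rE lee_fin.
  have rs' : r `^ s' <= t ^+ n.
    rewrite -lee_fin; apply: le_trans wn; rewrite /w /diameter_pow UN rE poweR_EFin.
    by rewrite leeDl// lee_fin divr_ge0// ltW.
  have rs : r `^ s <= t ^+ n.
    apply: le_trans rs'; have [->|rn0] := eqVneq r 0.
      by rewrite powR0 ?gt_eqF// powR_ge0.
    apply: ger_powR; last exact: ltW.
    by rewrite r1 andbT lt_neqAle eq_sym rn0.
  have tn : t ^+ n = (b%:R ^+ n)^-1 `^ s.
    rewrite /t -powR_mulrn ?powR_ge0// -powRrM mulrC powRrM powR_mulrn ?invr_ge0//.
    by rewrite exprVn.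
  rewrite tn in rs.
  have rb : r <= (b%:R ^+ n)^-1.
    rewrite leNgt; apply/negP => lt; move: rs; rewrite leNgt => /negP; apply.
    by apply: gt0_ltr_powR => //; rewrite nnegrE ?invr_ge0 ?exprn_ge0.
  apply: le_trans rb; apply: le_trans xyr.
  by have := enorm_coord (x - y) j; rewrite !mxE.
- apply: (@le_trans _ _ (\sum_(0 <= i <oo) w i)%E).
    by apply: lee_nneseries => [i _ _|i _]; case: asboolP => // _; exact: ltW.
  apply: (@le_trans _ _ (\sum_(0 <= i <oo) diameter_pow s' (U i) + (t / 2)%:E)%E).
    by apply: epsilon_trick; [move=> i; exact: diameter_pow_ge0|exact: ltW].
  rewrite [leRHS](_ : _ = ((t / 2)%:E + (t / 2)%:E)%E); last by rewrite -EFinD -splitr.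
  by rewrite leeD2r// ltW.
- by have [i _ Ui] := AU x Ax; exact: nU i Ui.
Qed.

End HausdorffLower.

(** * The Hausdorff dimension is at most d *)

Section HausdorffUpper.
Variables (R : realType) (d : nat).
Local Notation N := (@euclidean_norm R d).

Lemma nneseries_uncurry (f : nat * nat -> \bar R) (e : {bij [set: nat] >-> [set: nat * nat]}) :
  (forall p, 0 <= f p)%E ->
  (\sum_(0 <= i <oo) f (e i) = \sum_(0 <= m <oo) \sum_(0 <= n <oo) f (m, n))%E.
Proof.
move=> f0; rewrite nneseries_esumT; last by move=> ?.
rewrite -(@reindex_esum _ _ _ [set: nat] [set: nat * nat] e f); last exact: bij.
rewrite nneseries_esumT; last by move=> ?; exact: nneseries_ge0.
under [RHS]eq_esum do rewrite nneseries_esumT//.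
rewrite (@esum_esum _ _ _ setT (fun=> setT) (fun m n => f (m, n)))//.
have -> : [set: nat] `*`` (fun=> [set: nat]) = [set: nat * nat].
  by apply/seteqP; split.
by apply: eq_esum => -[].
Qed.

Lemma diameter_cube (a : 'rV[R]_d) h : 0 <= h ->
  (diameter (cube a h) <= (d%:R * h)%:E)%E.
Proof.
move=> h0; apply: ge_ereal_sup => _ [->|[[x y] [/= xc yc] <-]].
  by rewrite lee_fin mulr_ge0.
rewrite lee_fin; apply: enorm_le => // i; rewrite !mxE ler_norml.
have /andP[x1 x2] := xc i; have /andP[y1 y2] := yc i.
by apply/andP; split; lra.
Qed.

Lemma diameter_set0 : diameter (set0 : set 'rV[R]_d) = 0%E.
Proof.
apply/eqP; rewrite eq_le diameter_ge0 andbT; apply: ge_ereal_sup => _ [->//|[[x y] [[]]]].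
Qed.

Lemma diameter_pow_set0 s : diameter_pow s (set0 : set 'rV[R]_d) = 0%E.
Proof. by rewrite /diameter_pow eqxx. Qed.

Lemma diameter_pow_cube s (a : 'rV[R]_d) h : 0 <= s -> 0 <= h ->
  (diameter_pow s (cube a h) <= ((d%:R * h) `^ s)%:E)%E.
Proof.
move=> s0 h0; rewrite /diameter_pow; case: ifP => [_|_]; first by rewrite lee_fin powR_ge0.
rewrite -poweR_EFin; apply: gt0_ler_poweR => //; last exact: diameter_cube.
  by rewrite in_itv/= diameter_ge0 leey.
by rewrite in_itv/= lee_fin mulr_ge0//= leey.
Qed.

Lemma cube_sub_children (b : nat) (a x : 'rV[R]_d) h : (0 < b)%N -> 0 < h ->
  cube a h x -> exists c, cube (@child R d b a h c) (h / b%:R) x.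
Proof.
move=> b0 h0 xa; have b0' : 0 < b%:R :> R by rewrite ltr0n.
set g := h / b%:R; have g0 : 0 < g by rewrite divr_gt0.
have gb : g * b%:R = h by rewrite /g divfK// gt_eqF.
have /boolp.choice[f Hf] : forall i, exists t : 'I_b,
    a 0 i + g * t%:R <= x 0 i <= a 0 i + g * t%:R + g.
  move=> i; have /andP[x1 x2] := xa i; pose y := (x 0 i - a 0 i) / g.
  have y0 : 0 <= y by rewrite divr_ge0 ?subr_ge0// ltW.
  have yE : x 0 i = a 0 i + g * y by rewrite /y mulrC divfK ?gt_eqF// addrC subrK.
  have [yb|by_] := ltP y b%:R.
    have /andP[t1 t2] := truncn_itv y0.
    have tb : (Num.truncn y < b)%N by rewrite -(ltr_nat R) (le_lt_trans t1).
    exists (Ordinal tb); rewrite yE/= lerD2l ler_pM2l// t1/=.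
    by rewrite -addrA lerD2l -[X in _ + X]mulr1 -mulrDr ler_pM2l// natr1 ltW.
  (* On the upper face, where [y = b], the truncation would leave the range; the last subcube
     contains the point. *)
  have tb : (b.-1 < b)%N by rewrite ltn_predL.
  have bE : b.-1%:R + 1 = b%:R :> R by rewrite natr1 prednK.
  exists (Ordinal tb); rewrite /=; apply/andP; split.
    rewrite yE lerD2l ler_pM2l//; apply: le_trans by_.
    by rewrite -bE lerDl.
  by rewrite -addrA -[X in _ + (_ + X)]mulr1 -mulrDr bE gb.
exists (finfun f) => i; rewrite mxE ffunE; exact: Hf.
Qed.

Lemma unit_cube_cover (z : 'rV[R]_d) (s r eps : R) : (0 < d)%N -> d%:R < s ->
  0 < r -> 0 < eps ->
  exists V : nat -> set 'rV[R]_d, [/\ cube z 1 `<=` \bigcup_j V j,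
    forall j, (diameter (V j) <= r%:E)%E &
    (\sum_(0 <= j <oo) diameter_pow s (V j) <= eps%:E)%E].
Proof.
move=> d0 ds r0 eps0.
have D0 : 0 < d%:R :> R by rewrite ltr0n.
have s0 : 0 < s by apply: lt_trans ds.
(* M^d (d / M)^s <= eps as soon as M^(s - d) >= d^s / eps *)
have [M [M0 Mr Me]] : exists M : nat, [/\ (0 < M)%N, d%:R / M%:R <= r &
    M%:R ^+ d * (d%:R / M%:R) `^ s <= eps].
  pose A := Num.max (d%:R / r) (((d%:R `^ s) / eps) `^ (s - d%:R)^-1).
  have A0 : 0 < A by rewrite lt_max divr_gt0.
  exists (Num.truncn A).+1.
  have /andP[_ AM] := truncn_itv (ltW A0); set M : R := _%:R in AM *.
  have M0 : 0 < M by rewrite (lt_trans A0).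
  split => //.
    rewrite ler_pdivrMr// mulrC -ler_pdivrMr// (le_trans _ (ltW AM))//.
    by rewrite le_max lexx.
  have sd0 : 0 < s - d%:R by rewrite subr_gt0.
  have H : d%:R `^ s / eps <= M `^ (s - d%:R).
    have X0 : 0 <= d%:R `^ s / eps by rewrite divr_ge0 ?powR_ge0// ltW.
    have -> : d%:R `^ s / eps = ((d%:R `^ s / eps) `^ (s - d%:R)^-1) `^ (s - d%:R).
      by rewrite -powRrM mulVf ?gt_eqF// powRr1.
    apply: ge0_ler_powR; rewrite ?nnegrE ?powR_ge0 ?(ltW M0) ?(ltW sd0)//.
    by apply: le_trans (ltW AM); rewrite le_max lexx orbT.
  rewrite powRM ?invr_ge0 ?(ltW D0) ?(ltW M0)// mulrCA.
  have -> : M ^+ d * M^-1 `^ s = (M `^ (s - d%:R))^-1.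
    have E : M^-1 `^ s = M `^ (- s).
      by rewrite -(powR_inv1 (ltW M0)) -powRrM mulN1r.
    rewrite E -powR_mulrn ?(ltW M0)// -powRD; last by rewrite (gt_eqF M0) implybT.
    by rewrite -powRN opprB.
  by rewrite ler_pdivrMr ?powR_gt0// -ler_pdivrMl// mulrC.
have M0' : 0 < M%:R :> R by rewrite ltr0n.
pose T := {ffun 'I_d -> 'I_M}.
(* After the [M^d] subcubes the sequence continues with empty sets, which contribute 0. *)
pose V j := if nth None (map Some (enum T)) j is Some c then cube (child z 1 c) (1 / M%:R) else set0.
exists V; split.
- move=> x xz; have [c xc] := cube_sub_children M0 ltr01 xz.
  exists (index c (enum T)) => //; rewrite /V (nth_map c) ?index_mem ?mem_enum//.
  by rewrite nth_index ?mem_enum.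
- move=> j; rewrite /V; case: (nth _ _ _) => [c|]; last by rewrite diameter_set0 lee_fin ltW.
  apply: le_trans (diameter_cube _ _) _; first by rewrite divr_ge0.
  by rewrite lee_fin mul1r.
- rewrite (nneseries_split 0 #|T|); last by move=> j _; exact: diameter_pow_ge0.
  rewrite add0n eseries0 ?adde0; last first.
    move=> j Tj _; rewrite /V nth_default ?diameter_pow_set0//.
    by rewrite size_map -cardE.
  apply: (@le_trans _ _ (\sum_(0 <= j < #|T|) ((d%:R / M%:R) `^ s)%:E)%E).
    apply: lee_sum => j _; rewrite /V; case: (nth _ _ _) => [c|].
      apply: le_trans (diameter_pow_cube _ (ltW s0) _) _; first by rewrite divr_ge0.
      by rewrite mul1r.
    by rewrite diameter_pow_set0 lee_fin powR_ge0.
  rewrite sumEFin sumr_const_nat subn0 lee_fin card_ffun !card_ord -[leLHS]mulr_natl.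
  by rewrite natrX.
Qed.

(** Space is the union of the integral translates of the unit cube. The [n]-th one is covered at
    cost [eps / 2^(n+1)], and a bijection between [nat] and [nat * nat] merges the covers. *)
Lemma hausdorff_measure_eq0 (A : set 'rV[R]_d) (s : R) : (0 < d)%N -> d%:R < s ->
  hausdorff_measure s A = 0%E.
Proof.
move=> d0 ds; apply/eqP; rewrite eq_le; apply/andP; split; last first.
  apply: le_trans (hausdorff_premeasure_ge0 s 1 A) _.
  by apply: ereal_sup_ubound; exists 1 => //=.
apply: ge_ereal_sup => _ [r /= r0 <-].
apply/lee_addgt0Pr => eps eps0; rewrite add0e.
have /card_esym/ppcard_eqP[e] := card_nat2.
(* Numbers that encode no integral vector repeat the translate at 0, which does no harm to the
   cover. *)
pose z n : 'rV[R]_d := if unpickle n is Some p then map_mx intr (p : 'rV[int]_d) else 0.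
have /boolp.choice[V HV] : forall n, exists V : nat -> set 'rV[R]_d,
    [/\ cube (z n) 1 `<=` \bigcup_j V j, forall j, (diameter (V j) <= r%:E)%E &
    (\sum_(0 <= j <oo) diameter_pow s (V j) <= (eps / (2 ^ n.+1)%:R)%:E)%E].
  by move=> n; apply: unit_cube_cover => //; rewrite divr_gt0// ltr0n expn_gt0.
apply: (@le_trans _ _ (\sum_(0 <= i <oo) diameter_pow s (V (e i).1 (e i).2))%E).
  apply: ereal_inf_lbound; exists (fun i => V (e i).1 (e i).2) => //; split; last first.
    by move=> i; have [_ + _] := HV (e i).1; exact.
  move=> x _; pose p : 'rV[int]_d := \row_i Num.floor (x 0 i).
  have xp : cube (z (pickle p)) 1 x.
    move=> i; rewrite /z pickleK !mxE.
    by have /andP[-> /ltW] := floor_itv (x 0 i); rewrite intrD => ->.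
  have [sub _ _] := HV (pickle p); have [j _ xj] := sub x xp.
  exists (e^-1%FUN (pickle p, j)) => //=.
  by rewrite invK ?inE.
rewrite (nneseries_uncurry (f := fun p => diameter_pow s (V p.1 p.2))); last first.
  by move=> ?; exact: diameter_pow_ge0.
apply: le_trans (epsilon_trick0 _ (ltW eps0)).
apply: lee_nneseries => [n _ _|n _]; first by apply: nneseries_ge0 => ? _ _; exact: diameter_pow_ge0.
by have [] := HV n.
Qed.

Lemma hausdorff_dim_le (A : set 'rV[R]_d) : (0 < d)%N -> (hausdorff_dim A <= d%:R%:E)%E.
Proof.
move=> d0; apply/lee_addgt0Pr => eps eps0; rewrite -EFinD.
apply: ereal_inf_lbound; exists (d%:R + eps) => //; split.
  by rewrite addr_ge0// ltW.
by apply: hausdorff_measure_eq0; rewrite // ltrDl.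
Qed.

End HausdorffUpper.

(** * Choice of the parameters *)

Section LowerBound.
Variables (R : realType) (k : nat).
Local Notation d := k.+1.
Local Notation N := (@euclidean_norm R d).

(** Since [b^d * b^-(d - eta) = b^eta] is unbounded, any dimension below [d] is reached by a large
    base; [b > 2 K] keeps more than half of the subcubes. *)
Lemma base_exists (eta : R) : 0 < eta -> exists b : nat,
  ((4 * d).+1 < b)%N /\
  2 * 5 ^+ d < b%:R ^+ k * (b%:R - (4 * d).+1%:R) * (b%:R^-1 `^ (d%:R - eta)) :> R.
Proof.
move=> eta0; set K : R := (4 * d).+1%:R.
have K0 : 0 < K by rewrite ltr0n.
pose A := Num.max (2 * K) ((4 * 5 ^+ d) `^ eta^-1).
have A0 : 0 < A by rewrite lt_max mulr_gt0.
exists (Num.truncn A).+1; have /andP[_ AM] := truncn_itv (ltW A0).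
set b := (Num.truncn A).+1 in AM *.
have b0 : 0 < b%:R :> R by rewrite ltr0n.
have bK : 2 * K < b%:R by apply: le_lt_trans AM; rewrite le_max lexx.
have bA : (4 * 5 ^+ d) `^ eta^-1 < b%:R by apply: le_lt_trans AM; rewrite le_max lexx orbT.
split; first by rewrite -(ltr_nat R); move: bK K0; rewrite /K; lra.
have F0 : 0 <= 4 * 5 ^+ d :> R by rewrite mulr_ge0// exprn_ge0.
have bE : 4 * 5 ^+ d < b%:R `^ eta.
  have -> : 4 * 5 ^+ d = ((4 * 5 ^+ d) `^ eta^-1) `^ eta :> R.
    by rewrite -powRrM mulVf ?gt_eqF// powRr1.
  by apply: gt0_ltr_powR; rewrite ?nnegrE ?powR_ge0// ltW.
have tE : b%:R^-1 `^ (d%:R - eta) = b%:R `^ (eta - d%:R).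
  by rewrite -(powR_inv1 (ltW b0)) -powRrM mulN1r opprB.
have bb : b%:R ^+ d * b%:R `^ (eta - d%:R) = b%:R `^ eta.
  rewrite -powR_mulrn ?(ltW b0)// -powRD; last by rewrite (gt_eqF b0) implybT.
  by rewrite addrC subrK.
have t0 : 0 < b%:R `^ (eta - d%:R) by rewrite powR_gt0.
rewrite tE; apply: (@lt_le_trans _ _ (2^-1 * (b%:R ^+ d * b%:R `^ (eta - d%:R)))).
  by rewrite bb; move: bE; lra.
rewrite mulrA ler_pM2r// exprSr mulrCA ler_pM2l ?exprn_gt0//.
by move: bK; lra.
Qed.

(** The constant [c] is fixed from [b] alone, after which every condition on [e] is an upper
    bound. *)
Lemma special_threshold (b : nat) :
  let e1 := bad_const R d b in
  let M := 1 + d%:R * b%:R ^+ 2 in let kappa := e1 / (4 * d%:R) in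
  let A' := 2 ^+ k * (3 * (2 * d%:R) ^+ d / e1 ^+ d.+1) in
  (0 < b)%N -> exists2 e0 : R, 0 < e0 & forall e, 0 < e < e0 ->
  exists c, [/\ 0 < c, c <= 1, e <= c, 2 * e <= e1 &
    [/\ 2 * d%:R * b%:R ^+ 2 * e <= c ^+ d.+1, A' ^+ 2 * M ^+ k * c <= 1,
    A' ^+ 2 * (M * e) <= kappa ^+ k & M * e <= 1]].
Proof.
move=> e1 M kappa A' b_gt0.
have b0 : 0 < b%:R :> R by rewrite ltr0n.
have e10 : 0 < e1 by exact: bad_const_gt0.
have M1 : 1 <= M by rewrite lerDl mulr_ge0 ?exprn_ge0.
have M0 : 0 < M by rewrite (lt_le_trans ltr01).
have kap0 : 0 < kappa by rewrite divr_gt0// mulr_gt0// ltr0n.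
have A'0 : 0 < A'.
  apply: mulr_gt0; first exact: exprn_gt0.
  apply: divr_gt0; last exact: exprn_gt0.
  by apply: mulr_gt0 => //; apply: exprn_gt0; apply: mulr_gt0; rewrite ?ltr0n.
have X0 : 0 < A' ^+ 2 * M ^+ k by rewrite mulr_gt0 ?exprn_gt0.
pose c := Num.min 1 (A' ^+ 2 * M ^+ k)^-1.
have c0 : 0 < c by rewrite lt_min ltr01 invr_gt0.
have c1 : c <= 1 by rewrite ge_min lexx.
have cX : c <= (A' ^+ 2 * M ^+ k)^-1 by rewrite ge_min lexx orbT.
clearbody c.
have D0 : 0 < 2 * d%:R * b%:R ^+ 2 :> R by rewrite !mulr_gt0 ?exprn_gt0 ?ltr0n.
have E0 : 0 < A' ^+ 2 * M by rewrite mulr_gt0 ?exprn_gt0.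
exists (Num.min c (Num.min (e1 / 2) (Num.min (c ^+ d.+1 / (2 * d%:R * b%:R ^+ 2))
  (Num.min (kappa ^+ k / (A' ^+ 2 * M)) M^-1)))).
  by rewrite !lt_min c0 invr_gt0 M0 !divr_gt0 ?exprn_gt0.
move=> e /andP[e0]; rewrite !lt_min => /and5P[h1 h2 h3 h4 h5].
exists c; split => //.
- exact: ltW.
- by rewrite mulrC -ler_pdivlMr// ltW.
- split.
  + by rewrite mulrC -ler_pdivlMr// ltW.
  + by rewrite mulrC -ler_pdivlMr// mul1r.
  + by rewrite mulrA mulrC -ler_pdivlMr// ltW.
  + by rewrite mulrC -ler_pdivlMr// mul1r ltW.
Qed.

Lemma window_dim_ge (eta : R) : (0 < k)%N -> 0 < eta ->
  exists2 e0 : R, 0 < e0 & forall e, 0 < e < e0 ->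
    ((d%:R - eta)%:E <= hausdorff_dim [set x : 'rV[R]_d |
       (e%:E <= Theta N x <= (e * (1 + e ^+ d))%:E)%E])%E.
Proof.
(* The criterion [hausdorff_dim_ge] concerns positive exponents; otherwise the bound is trivial. *)
move=> k0 eta0; have [s0|s0] := leP (d%:R - eta) 0.
  exists 1 => // e _; apply: le_trans (hausdorff_dim_ge0 _).
  by rewrite lee_fin.
have [b [bd many]] := base_exists eta0.
have b2 : (2 <= b)%N by apply: leq_ltn_trans bd.
have b0 : 0 < b%:R :> R by rewrite ltr0n; exact: leq_trans b2.
have [e0 e00 He] := special_threshold (leq_trans (ltnSn 0) (ltnW b2)).
exists e0 => // e /[dup] /andP[e_gt0 _] /He [c [c0 c1 ec He1 [H2 H3 H4 H5]]].
have ee1 : e <= bad_const R d b by move: e_gt0 He1; clear; lra.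
apply: (hausdorff_dim_ge b2 s0) => U w w0 diamU mT.
have t0 : 0 < b%:R^-1 `^ (d%:R - eta) :> R by rewrite powR_gt0// invr_gt0.
have t1 : b%:R^-1 `^ (d%:R - eta) < 1 :> R.
  rewrite -[ltRHS](_ : 1 `^ (d%:R - eta) = 1); last by rewrite powR1.
  apply: gt0_ltr_powR; rewrite ?nnegrE ?invr_ge0 ?(ltW b0)//.
  by rewrite invf_lt1// (ltr_nat R 1).
have special := special_step k0 bd e_gt0 c0 c1 ec He1 H2 H3 H4 H5.
have [x [xav xap xU]] := cantor_point w0 bd e_gt0 ee1 t0 t1 many diamU special mT.
exists x => //=; apply/andP; split; first by apply: Theta_ge; rewrite // ltW.
apply: Theta_le => [|m]; last exact: xap.
by rewrite mulr_ge0 ?addr_ge0 ?exprn_ge0 ?ltW.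
Qed.

End LowerBound.

(** Turns positive dimension into non-emptiness. The exponent 0 is admissible because the empty set
    contributes 0 even then. *)
Lemma hausdorff_dim0 (R : realType) (d : nat) :
  hausdorff_dim (set0 : set 'rV[R]_d) = 0%E.
Proof.
apply/eqP; rewrite eq_le hausdorff_dim_ge0 andbT.
apply: ereal_inf_lbound; exists 0 => //; split => //.
apply/eqP; rewrite eq_le; apply/andP; split; last first.
  apply: le_trans (hausdorff_premeasure_ge0 0 1 set0) _.
  by apply: ereal_sup_ubound; exists 1 => //=.
apply: ge_ereal_sup => _ [r /= r0 <-]; apply: ereal_inf_lbound.
exists (fun=> set0); first by split=> // i; rewrite diameter_set0 lee_fin ltW.
by apply: eseries0 => i _ _; rewrite diameter_pow_set0.
Qed.

Theorem theorem1p1 (R : realType) (d : nat) (hd : (2 <= d)%N) :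
  (exists2 C0 : R, 0 < C0 &
    forall C : R, 0 < C < C0 ->
      exists2 delta : R, 0 < delta &
        forall eps : R, 0 < eps < C ->
          ([set t : \bar R |
              (eps%:E <= t <= (eps * (1 + delta * eps ^+ d))%:E)%E]
             `&` lagrange_spectrum (@euclidean_norm R d) !=set0)
          /\
          (0 < hausdorff_dim
             [set x : 'rV[R]_d |
                (eps%:E <= Theta (@euclidean_norm R d) x
                   <= (eps * (1 + delta * eps ^+ d))%:E)%E])%E)
  /\
  (forall Delta : R -> R,
     (forall r : R, 0 < r -> 0 < Delta r) ->
     Delta r @[r --> 0^'+] --> +oo ->
     hausdorff_dim
       [set x : 'rV[R]_d |
          (eps%:E <= Theta (@euclidean_norm R d) x
             <= (eps * (1 + Delta eps * eps ^+ d))%:E)%E]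
       @[eps --> 0^'+] --> (d%:R%:E : \bar R)).
Proof.
case: d hd => [//|k] k0; split.
  (* With [eta = 1] the dimension is at least [d - 1 = k], which is positive. *)
  have [C0 C00 HC] := window_dim_ge k0 (ltr01 : 0 < 1 :> R).
  exists C0 => // C /andP[C_gt0 CC0]; exists 1 => // eps /andP[eps0 epsC].
  have := HC eps; rewrite eps0 (lt_trans epsC CC0) => /(_ isT) dimE.
  have dim0 : (0 < hausdorff_dim [set x : 'rV[R]_k.+1 |
      (eps%:E <= Theta (@euclidean_norm R k.+1) x
        <= (eps * (1 + 1 * eps ^+ k.+1))%:E)%E])%E.
    rewrite mul1r; apply: lt_le_trans dimE.
    by rewrite lte_fin subr_gt0 (ltr_nat R 1).
  split=> //; apply: contrapT => no; move: dim0.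
  rewrite (_ : [set x | _] = set0) ?hausdorff_dim0 ?ltxx//.
  apply/seteqP; split => // x /= xE; apply: no.
  by exists (Theta (@euclidean_norm R k.+1) x); split => //; exists x.
move=> Delta Delta0 Deltay.
set f := fun eps : R => hausdorff_dim _.
have f_le eps : (f eps <= k.+1%:R%:E)%E by exact: hausdorff_dim_le.
have f_ge eta : 0 < eta -> \forall eps \near 0^'+, ((k.+1%:R - eta)%:E <= f eps)%E.
  move=> eta0; have [e0 e00 He] := window_dim_ge k0 eta0.
  have := (cvgryPge _).1 Deltay 1; move=> D1.
  near=> eps.
  have eps0 : 0 < eps by near: eps; exact: nbhs_right_gt.
  have epse : eps < e0 by near: eps; exact: nbhs_right_lt.
  (* Once [Delta eps >= 1], the window contains the one of [window_dim_ge]. *)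
  have De : 1 <= Delta eps by near: eps; exact: D1.
  have := He eps; rewrite eps0 epse => /(_ isT) /le_trans; apply.
  apply: hausdorff_dim_mono => x /= /andP[-> /le_trans]; apply.
  rewrite lee_fin ler_pM2l// lerD2l ler_peMl// exprn_ge0// ltW//.
have ffin eps : f eps \is a fin_num.
  rewrite ge0_fin_numE; last exact: hausdorff_dim_ge0.
  by rewrite (le_lt_trans (f_le eps))// ltry.
apply/fine_cvgP; split; first exact: nearW.
apply/cvgrPdist_le => eta eta0.
near=> eps.
have h1 : ((k.+1%:R - eta)%:E <= f eps)%E by near: eps; exact: f_ge.
have h2 := f_le eps; rewrite -(fineK (ffin eps)) !lee_fin in h1 h2 *.
rewrite /= ler_norml; apply/andP; split; lra.
Unshelve. all: by end_near.
Qed.
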